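(* Assume (A1) and (A2) of the context. Fix an integer $k\ge 2$. Let $\lambda\in\mathbb C$ be an eigenvalue of $-\mathcal L|_{\mathscr P_k}$, but not of $-\mathcal L|_{\mathscr P_{k-1}}$. Then $$\gamma(\mathcal L)\,\mathrm{gap}_{\rm RW}(\mathcal L)\le \mathrm{Re}(\lambda),$$ where $$\gamma(\mathcal L)=\min_{x\ne y\,:\,\pi_{xy}>0}\frac{\chi_{xy}+\sigma_{xy}}{\pi_{xy}},$$ with $$\chi_{xy}=\int_{[0,1]^2}[\beta_{xy}(\mathrm du,\mathrm dv)+\beta_{yx}(\mathrm dv,\mathrm du)]\,\big(\pi_x\,u(1-u)+\pi_y\,v(1-v)\big),$$ $$\sigma_{xy}=\int_{[0,1]^2}[\beta_{xy}(\mathrm du,\mathrm dv)+\beta_{yx}(\mathrm dv,\mathrm du)]\,\big(\pi_x(1-u)-\pi_y(1-v)\big)^2 .$$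
   Context: Setting. $V$ is a finite set, $|V|=n\ge 2$, and $\Omega=\{\eta=(\eta_x)_{x\in V}:\eta_x\ge 0,\ \sum_{x}\eta_x=1\}$, with elements viewed as row vectors. For distinct $x,y\in V$ and $u,v\in[0,1]$, $R_{xy}^{uv}$ is the $V\times V$ stochastic matrix determined by $(\eta R_{xy}^{uv})_x=u\eta_x+(1-v)\eta_y$, $(\eta R_{xy}^{uv})_y=(1-u)\eta_x+v\eta_y$, $(\eta R_{xy}^{uv})_z=\eta_z$ for $z\ne x,y$. For $x,y\in V$, $\beta_{xy}$ is a (possibly infinite) Borel measure on $[0,1]^2$, with $\beta_{xx}\equiv 0$. The generator is $$\mathcal L f(\eta)=\sum_{x,y\in V}\int_{[0,1]^2}\beta_{xy}(\mathrm du,\mathrm dv)\{f(\eta R_{xy}^{uv})-f(\eta)\},\qquad \eta\in\Omega,$$ with $\mathcal L1=0$. In integrals against $\beta_{yx}(\mathrm dv,\mathrm du)$, the first coordinate of $\beta_{yx}$ is the variable $v$ and the second is $u$. $\mathscr P_k$ denotes the space of functions $f:\Omega\to\mathbb C$ that are polynomials of degree at most $k$ in $(\eta_x)_{x\in V}$; under (A1), $\mathcal L$ is well-defined on polynomials and $\mathcal L\mathscr P_k\subset\mathscr P_k$. (A1) For all $x,y\in V$: $\int_{[0,1]^2}\beta_{xy}(\mathrm du,\mathrm dv)\{(1-u)+(1-v)\}<\infty$. (A2) Setting, for distinct $x,y$, $s_{xy}=\int_{[0,1]^2}[\beta_{xy}(\mathrm du,\mathrm dv)+\beta_{yx}(\mathrm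 dv,\mathrm du)]\,u(1-u)$: for all $x,y\in V$ there exist $x_1,\dots,x_\ell\in V$ with $s_{xx_1}s_{x_1x_2}\cdots s_{x_{\ell-1}x_\ell}s_{x_\ell y}>0$. Associated random walk (RW): it jumps on $V$ with rates, for distinct $x,y$, $r_{xy}=\int_{[0,1]^2}[\beta_{xy}(\mathrm du,\mathrm dv)+\beta_{yx}(\mathrm dv,\mathrm du)](1-u)$. Since $s_{xy}\le r_{xy}$, (A2) makes RW irreducible; $\pi=(\pi_x)_{x\in V}$ is its unique (positive) invariant probability, i.e. $\sum_{y\ne x}\pi_y r_{yx}=\pi_x\sum_{y\ne x}r_{xy}$. For distinct $x,y$ let $\pi_{xy}=\frac12(\pi_xr_{xy}+\pi_yr_{yx})$, and $$\mathcal E_{\rm RW}(\psi)=\frac12\sum_{x\neq y}\pi_{xy}(\psi(y)-\psi(x))^2,\qquad \mathrm{gap}_{\rm RW}(\mathcal L)=\inf\{\mathcal E_{\rm RW}(\psi):\psi\in\mathbb R^V,\ \|\psi-\pi\psi\|_{L^2(\pi)}=1\},$$ with $\pi\psi=\sum_x\pi_x\psi(x)$. *)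

(* Defs.v *)
From HB Require Import structures.
From mathcomp Require Import all_boot all_order all_algebra.
From mathcomp Require Import -(notations) mpoly.
From mathcomp Require Import all_classical all_reals all_analysis.
From mathcomp Require Import complex ring.

Set Implicit Arguments.
Unset Strict Implicit.
Unset Printing Implicit Defensive.

Import Order.TTheory GRing.Theory Num.Theory.
Import numFieldNormedType.Exports.

Local Open Scope classical_set_scope.
Local Open Scope ring_scope.

Definition in_simplex (R : realType) (V : finType) : pred {ffun V -> R} :=
  fun eta => [forall x, 0 <= eta x] && (\sum_x eta x == 1).

Record simplex (R : realType) (V : finType) := Simplex {
  weight :> {ffun V -> R};
  _ : in_simplex weight }.

HB.instance Definition _ (R : realType) (V : finType) :=
  [isSub for @weight R V].

(* The row vector eta *m R_{xy}^{uv}. *)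
Definition jump (R : realType) (V : finType) (x y : V) (u v : R)
    (eta : {ffun V -> R}) : {ffun V -> R} :=
  [ffun z => if z == x then u * eta x + (1 - v) * eta y
             else if z == y then (1 - u) * eta x + v * eta y
             else eta z].

Lemma jump_in_simplex (R : realType) (V : finType) (x y : V) (u v : R)
    (eta : simplex R V) : x != y -> 0 <= u <= 1 -> 0 <= v <= 1 ->
  in_simplex (jump x y u v eta).
Proof.
case: eta => eta /= /andP[/forallP eta_ge0 /eqP eta_sum] xy.
move=> /andP[u0 u1] /andP[v0 v1]; apply/andP; split.
  apply/forallP => z; rewrite ffunE.
  by do 2?[case: ifP => _]; rewrite ?addr_ge0 ?mulr_ge0 ?subr_ge0.
have yx : y != x by rewrite eq_sym.
have split_sum (h : V -> R) :
    \sum_z h z = h x + (h y + \sum_(z | (z != x) && (z != y)) h z).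
  by rewrite (bigD1 x) //= (bigD1 y).
rewrite -eta_sum !split_sum !ffunE !eqxx (negbTE yx).
rewrite (eq_bigr (fun z => eta z)); last first.
  by move=> z /andP[zx zy]; rewrite ffunE (negbTE zx) (negbTE zy).
rewrite !addrA; apply/eqP; congr (_ + _).
by ring.
Qed.

Definition unit_square (R : realType) : set (R * R) :=
  [set` `[0, 1]%R] `*` [set` `[0, 1]%R].
Arguments unit_square R : clear implicits.

(* A possibly infinite Borel measure on [0,1]^2 is represented by a Borel
   measure on R^2, of which only the restriction to unit_square is ever used. *)
Definition square_measures (R : realType) (V : finType) :=
  V -> V -> {measure set (measurableTypeR R * measurableTypeR R) -> \bar R}.

Definition cintegral (d : measure_display) (T : measurableType d)
    (R : realType) (mu : {measure set T -> \bar R}) (D : set T)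
    (g : T -> R[i]) : R[i] :=
  ((\int[mu]_(w in D) complex.Re (g w)) +i*
   (\int[mu]_(w in D) complex.Im (g w)))%C.

(* For w in unit_square, insubd is applied to an element of the simplex (lemma
   jump_in_simplex), so that its default value eta plays no role; the terms
   x = y vanish because beta x x is the null measure. *)
Definition generator (R : realType) (V : finType) (beta : square_measures R V)
    (f : simplex R V -> R[i]) (eta : simplex R V) : R[i] :=
  \sum_(x : V) \sum_(y : V)
    cintegral (beta x y) (unit_square R)
      (fun w => f (insubd eta (jump x y w.1 w.2 eta)) - f eta).

(* msize is one more than the total degree (and 0 for the zero polynomial). *)
Definition poly_functions (R : realType) (V : finType) (k : nat) :
    set (simplex R V -> R[i]) :=
  [set f | exists p : mpoly #|V| R[i],
     (msize p <= k.+1)%N /\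
     forall eta : simplex R V,
       f eta = meval (fun i => (eta (enum_val i))%:C%C) p].

Definition eigenvalue_on (R : realType) (V : finType)
    (A : (simplex R V -> R[i]) -> (simplex R V -> R[i]))
    (P : set (simplex R V -> R[i])) (lambda : R[i]) : Prop :=
  exists f, [/\ P f, f <> (fun=> 0) & A f = (fun eta => lambda * f eta)].

(* The integral of g(u,v) against beta_xy(du,dv) + beta_yx(dv,du). *)
Definition sym_integral (R : realType) (V : finType)
    (beta : square_measures R V) (x y : V) (g : R -> R -> R) : R :=
  (\int[beta x y]_(w in unit_square R) g w.1 w.2) +
  (\int[beta y x]_(w in unit_square R) g w.2 w.1).

Definition assumption_A1 (R : realType) (V : finType)
    (beta : square_measures R V) : Prop :=
  forall x y : V,
    (\int[beta x y]_(w in unit_square R) ((1 - w.1) + (1 - w.2))%:E < +oo)%E.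

Definition swap_rate (R : realType) (V : finType)
    (beta : square_measures R V) (x y : V) : R :=
  sym_integral beta x y (fun u _ => u * (1 - u)).

(* If s = [:: x_1; ...; x_l], the product is s_{x x_1} s_{x_1 x_2} ...
   s_{x_l y}. Factors with equal indices vanish since beta x x is null. *)
Definition assumption_A2 (R : realType) (V : finType)
    (beta : square_measures R V) : Prop :=
  forall x y : V, exists s : seq V,
    0 < \prod_(t <- pairmap (swap_rate beta) x (rcons s y)) t.

Definition rw_rate (R : realType) (V : finType)
    (beta : square_measures R V) (x y : V) : R :=
  sym_integral beta x y (fun u _ => 1 - u).

Definition rw_invariant (R : realType) (V : finType)
    (beta : square_measures R V) (pi : V -> R) : Prop :=
  [/\ forall x, 0 <= pi x, \sum_x pi x = 1 &
      forall x, \sum_(y | y != x) pi y * rw_rate beta y x =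
                pi x * \sum_(y | y != x) rw_rate beta x y].

Definition rw_conductance (R : realType) (V : finType)
    (beta : square_measures R V) (pi : V -> R) (x y : V) : R :=
  2^-1 * (pi x * rw_rate beta x y + pi y * rw_rate beta y x).

Definition rw_dirichlet (R : realType) (V : finType)
    (beta : square_measures R V) (pi : V -> R) (psi : V -> R) : R :=
  2^-1 * \sum_(x : V) \sum_(y | x != y)
    rw_conductance beta pi x y * (psi y - psi x) ^+ 2.

Definition mean (R : realType) (V : finType) (pi psi : V -> R) : R :=
  \sum_x pi x * psi x.

Definition l2norm (R : realType) (V : finType) (pi psi : V -> R) : R :=
  Num.sqrt (\sum_x pi x * psi x ^+ 2).

Definition rw_gap (R : realType) (V : finType)
    (beta : square_measures R V) (pi : V -> R) : R :=
  inf [set rw_dirichlet beta pi psi | psi in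
         [set psi : V -> R | l2norm pi (fun x => psi x - mean pi psi) = 1]].

Definition chi (R : realType) (V : finType)
    (beta : square_measures R V) (pi : V -> R) (x y : V) : R :=
  sym_integral beta x y
    (fun u v => pi x * (u * (1 - u)) + pi y * (v * (1 - v))).

Definition sigma (R : realType) (V : finType)
    (beta : square_measures R V) (pi : V -> R) (x y : V) : R :=
  sym_integral beta x y
    (fun u v => (pi x * (1 - u) - pi y * (1 - v)) ^+ 2).

(* The infimum is a minimum: the set is finite, and nonempty under (A2) when
   #|V| >= 2. *)
Definition gamma (R : realType) (V : finType)
    (beta : square_measures R V) (pi : V -> R) : R :=
  inf [set (chi beta pi xy.1 xy.2 + sigma beta pi xy.1 xy.2) /
             rw_conductance beta pi xy.1 xy.2 | xy in
         [set xy : V * V | xy.1 != xy.2 /\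
                           0 < rw_conductance beta pi xy.1 xy.2]].

(* Main.v *)
(* Every polynomial of degree at most k on the simplex is E_k phi (eta) =
   sum over w in V^k of phi(w) eta^w, and L E_k = E_k M_k for a real matrix M_k,
   the integral of R^{(x)k} - 1. As lambda is not an eigenvalue in degree k - 1,
   a transposed eigenvector omega of M_k for -lambda vanishes on all phi with
   E_k phi of degree k - 1, in particular on every phi that does not depend on
   one of its variables; so omega(psi1 (x) psi2 (x) Psi) depends on psi1, psi2
   only modulo constants. Maximise its modulus over psi1, psi2 of variance 1 in
   L^2(pi) and |Psi| <= 1. Since |R^{(x)(k-2)} Psi| <= 1, at the maximum
   Re(lambda) is at least half the sum over i = 1, 2 of the rate at which the
   generator decreases Var_pi(psi_i), that is of
   1/2 sum_{x,y} (chi_xy + sigma_xy) (psi_i(y) - psi_i(x))^2 >= gamma gap. *)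

Require Import Defs.
From HB Require Import structures.
From mathcomp Require Import all_boot all_order all_algebra.
From mathcomp Require Import -(notations) mpoly.
From mathcomp Require Import all_classical all_reals all_analysis measurable_realfun.
From mathcomp Require Import complex ring lra.
Set Implicit Arguments.
Unset Strict Implicit.
Unset Printing Implicit Defensive.
Import Order.TTheory GRing.Theory Num.Theory.
Import numFieldNormedType.Exports.
Local Open Scope classical_set_scope.
Local Open Scope ring_scope.

(** Nothing is assumed reversible: [lambda] and its eigenfunction may be complex, and no variational
    formula for the spectrum is at hand. The maximum argument for omega takes its place.
    Coefficients on V^k are moreover not determined by the function they represent, so an
    eigenfunction yields only a phi for which M_k phi + lambda phi represents zero. Dividing by all
    coefficients of lower-degree functions removes this ambiguity together with the lower-degree
    terms.

    Two factors are split off because the variance is quadratic. If B is the maximum, the form is at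
    most B times the square root of Var(psi1) Var(psi2), hence at most B/2 times the sum of the
    variances; the factor 1/2 is made up for by the two summands. A single factor would give only
    half of the bound, and this is where k >= 2 enters.

    A single jump may increase the variance: besides chi and sigma, its effect contains a drift
    term, which cancels only after summation over all pairs, by invariance of pi. *)

(** * Tensor powers of the jump matrices *)

Fixpoint tuples (V : finType) (k : nat) : finType :=
  if k is k'.+1 then (V * tuples V k')%type else unit.

Section Transitions.
Variables (R : realType) (V : finType).
Implicit Types (x y : V) (w : R * R) (K : V -> V -> R) (k : nat).

(** The matrix R_{xy}^{uv} with w = (u, v). For x = y it is the identity, whereas [jump x x]
    rescales the weight at x. *)
Definition transition x y w (a b : V) : R :=
  if a == x then w.1 * (b == x)%:R + (1 - w.1) * (b == y)%:R
  else if a == y then (1 - w.2) * (b == x)%:R + w.2 * (b == y)%:R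
  else (b == a)%:R.

(** Tuples are nested pairs, so that splitting off leading variables holds by conversion. *)
Fixpoint monomial (eta : V -> R) k : tuples V k -> R :=
  if k is k'.+1 return tuples V k -> R then fun a => eta a.1 * monomial eta a.2
  else fun=> 1.

Fixpoint tensor K k : tuples V k -> tuples V k -> R :=
  if k is k'.+1 return tuples V k -> tuples V k -> R then
    fun a b => K a.1 b.1 * tensor K a.2 b.2
  else fun _ _ => 1.

Lemma sum_tuplesS (W : nmodType) k (F : tuples V k.+1 -> W) :
  \sum_a F a = \sum_x \sum_a F (x, a).
Proof.
by rewrite pair_bigA; apply: eq_bigr => -[].
Qed.

Lemma sum_tuplesSS (W : nmodType) k (F : tuples V k.+2 -> W) :
  \sum_a F a = \sum_x \sum_y \sum_a F (x, (y, a)).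
Proof.
rewrite sum_tuplesS; apply: eq_bigr => x _.
exact: (@sum_tuplesS _ k (fun a => F (x, a))).
Qed.

Lemma sum_delta (c : V) (F : V -> R) : \sum_b (b == c)%:R * F b = F c.
Proof.
rewrite (bigD1 c) //= eqxx mul1r big1 ?addr0 // => b /negbTE ->.
by rewrite mul0r.
Qed.

Lemma transition_act x y w (psi : V -> R) a :
  \sum_b transition x y w a b * psi b =
  if a == x then w.1 * psi x + (1 - w.1) * psi y
  else if a == y then (1 - w.2) * psi x + w.2 * psi y else psi a.
Proof.
have two s t : \sum_b (s * (b == x)%:R + t * (b == y)%:R) * psi b =
               s * psi x + t * psi y.
  under eq_bigr do rewrite mulrDl -!mulrA.
  by rewrite big_split /= -!mulr_sumr !sum_delta.
rewrite /transition; case: ifP => _; first exact: two.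
by case: ifP => _; [exact: two|exact: sum_delta].
Qed.

Lemma transition_row_sum x y w a : \sum_b transition x y w a b = 1.
Proof.
under eq_bigr do rewrite -[transition _ _ _ _ _]mulr1.
rewrite (transition_act x y w (fun=> 1)) !mulr1.
by case: ifP => _; [ring|case: ifP => _ //; ring].
Qed.

Lemma jump_transition x y w (eta : {ffun V -> R}) b : x != y ->
  jump x y w.1 w.2 eta b = \sum_a eta a * transition x y w a b.
Proof.
move=> xy; have yx : y != x by rewrite eq_sym.
rewrite ffunE (bigD1 x) //= (bigD1 y) //= /transition eqxx (negbTE yx) eqxx.
have -> : \sum_(a | (a != x) && (a != y)) eta a *
    (if a == x then w.1 * (b == x)%:R + (1 - w.1) * (b == y)%:R
     else if a == y then (1 - w.2) * (b == x)%:R + w.2 * (b == y)%:R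
     else (b == a)%:R) =
    if (b != x) && (b != y) then eta b else 0.
  rewrite (eq_bigr (fun a => if b == a then eta a else 0)); last first.
    move=> a /andP[/negbTE -> /negbTE ->].
    by case: ifP => _; rewrite ?mulr1 ?mulr0.
  rewrite -big_mkcondr /=; case: ifP => [bxy|/negbT bxy].
    rewrite (big_pred1 b) // => a /=; rewrite [a == b]eq_sym.
    by case: (eqVneq b a) => [<-|_]; rewrite ?andbT ?andbF.
  rewrite big_pred0 // => a.
  by case: (eqVneq b a) => [<-|_]; rewrite ?andbF // (negbTE bxy).
have [->|bx] := eqVneq b x; first by rewrite (negbTE xy) /=; ring.
by case: eqVneq => _ /=; ring.
Qed.

Lemma transition_ge0 x y w a b : 0 <= w.1 <= 1 -> 0 <= w.2 <= 1 ->
  0 <= transition x y w a b.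
Proof.
move=> /andP[? ?] /andP[? ?]; rewrite /transition.
by do ![case: ifP => _]; rewrite ?addr_ge0 ?mulr_ge0 ?subr_ge0 ?ler0n.
Qed.

Lemma tensor_ge0 K k (a b : tuples V k) :
  (forall c d, 0 <= K c d) -> 0 <= tensor K a b.
Proof. by move=> K0; elim: k a b => //= k IH a b; rewrite mulr_ge0. Qed.

Lemma tensor_row_sum K k (a : tuples V k) :
  (forall c, \sum_d K c d = 1) -> \sum_b tensor K a b = 1.
Proof.
move=> K1; elim: k a => [|k IH] a.
  by rewrite /= (big_pred1 tt) //; case.
rewrite sum_tuplesS /=.
by under eq_bigr do rewrite -mulr_sumr IH mulr1.
Qed.

Lemma tensor_delta k (a b : tuples V k) :
  tensor (fun c d => (d == c)%:R) a b = (b == a)%:R.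
Proof.
elim: k a b => [|k IH] /=; first by case; case.
by move=> [x a] [y b] /=; rewrite IH -natrM mulnb -xpair_eqE.
Qed.

(** Expanding the product of sums: moving eta by K moves its vector of degree k monomials by the
    k-th tensor power of K. This duality is why the generator acts on coefficients by a matrix. *)
Lemma monomial_act (eta : V -> R) K k (b : tuples V k) :
  monomial (fun z => \sum_a eta a * K a z) b =
  \sum_a monomial eta a * tensor K a b.
Proof.
elim: k b => [|k IH] b; first by rewrite /= (big_pred1 tt) ?mulr1 //; case.
rewrite sum_tuplesS /= IH mulr_suml; apply: eq_bigr => x _.
by rewrite mulr_sumr; apply: eq_bigr => a _ /=; rewrite mulrACA.
Qed.

Lemma eq_monomial (eta eta' : V -> R) k (b : tuples V k) :
  eta =1 eta' -> monomial eta b = monomial eta' b.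
Proof. by move=> e; elim: k b => //= k IH b; rewrite e IH. Qed.

End Transitions.

(** * Integrands controlled by (A1) *)

Section Admissible.
Variable R : realType.
Local Notation T := (measurableTypeR R * measurableTypeR R)%type.
Implicit Types (g h : R * R -> R) (w : R * R).

Definition square_bounded g :=
  measurable_fun (unit_square R) (g : T -> R) /\
  exists C, forall w, unit_square R w -> `|g w| <= C.

(** The measures may be infinite, and (A1) only provides the integrability of (1 - u) + (1 - v).
    Functions dominated by a multiple of it form a module over the bounded ones, and every integrand
    below is shown to lie in it. *)
Definition admissible g :=
  measurable_fun (unit_square R) (g : T -> R) /\
  exists2 C, 0 <= C &
    forall w, unit_square R w -> `|g w| <= C * ((1 - w.1) + (1 - w.2)).

Lemma unit_squareE w :
  unit_square R w <-> 0 <= w.1 <= 1 /\ 0 <= w.2 <= 1.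
Proof. by rewrite /unit_square; split => -[]; rewrite /= !in_itv. Qed.

Lemma measurable_unit_square : measurable (unit_square R : set T).
Proof. by apply: measurableX => //; exact: measurable_itv. Qed.

Lemma deficit_ge0 w : unit_square R w -> 0 <= (1 - w.1) + (1 - w.2).
Proof. by move/unit_squareE => [/andP[? ?] /andP[? ?]]; rewrite addr_ge0 ?subr_ge0. Qed.

Lemma square_bounded_cst c : square_bounded (fun=> c).
Proof. by split; [exact: measurable_cst|exists `|c|]. Qed.

Lemma square_bounded_fst : square_bounded fst.
Proof.
split; first exact: measurable_funTS measurable_fst.
by exists 1 => w /unit_squareE [/andP[? ?] _]; rewrite ger0_norm.
Qed.

Lemma square_bounded_snd : square_bounded snd.
Proof.
split; first exact: measurable_funTS measurable_snd.
by exists 1 => w /unit_squareE [_ /andP[? ?]]; rewrite ger0_norm.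
Qed.

Lemma square_boundedD g h : square_bounded g -> square_bounded h ->
  square_bounded (fun w => g w + h w).
Proof.
move=> [mg [C gC]] [mh [D hD]]; split; first exact: measurable_funD.
by exists (C + D) => w sw; rewrite (le_trans (ler_normD _ _)) // lerD ?gC ?hD.
Qed.

Lemma square_boundedM g h : square_bounded g -> square_bounded h ->
  square_bounded (fun w => g w * h w).
Proof.
move=> [mg [C gC]] [mh [D hD]]; split; first exact: measurable_funM.
by exists (C * D) => w sw; rewrite normrM ler_pM ?gC ?hD.
Qed.

Lemma square_boundedB g h : square_bounded g -> square_bounded h ->
  square_bounded (fun w => g w - h w).
Proof.
move=> bg bh; have := square_boundedD bg (square_boundedM (square_bounded_cst (-1)) bh).
by under eq_fun do rewrite mulN1r.
Qed.

Lemma admissibleD g h : admissible g -> admissible h ->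
  admissible (fun w => g w + h w).
Proof.
move=> [mg [C C0 gC]] [mh [D D0 hD]]; split; first exact: measurable_funD.
exists (C + D); first exact: addr_ge0.
by move=> w sw; rewrite (le_trans (ler_normD _ _)) // mulrDl lerD ?gC ?hD.
Qed.

Lemma admissibleM g h : square_bounded g -> admissible h ->
  admissible (fun w => g w * h w).
Proof.
move=> [mg [C gC]] [mh [D D0 hD]]; split; first exact: measurable_funM.
exists (`|C| * D); first exact: mulr_ge0.
move=> w sw; rewrite normrM -mulrA ler_pM ?hD //.
exact: le_trans (gC w sw) (ler_norm _).
Qed.

Lemma admissibleZ c g : admissible g -> admissible (fun w => c * g w).
Proof. exact/admissibleM/square_bounded_cst. Qed.

Lemma admissibleB g h : admissible g -> admissible h ->
  admissible (fun w => g w - h w).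
Proof.
move=> ag ah; have := admissibleD ag (admissibleZ (-1) ah).
by under eq_fun do rewrite mulN1r.
Qed.

Lemma admissible0 : admissible (fun=> 0).
Proof.
split; first exact: measurable_cst.
by exists 0 => // w _; rewrite normr0 mul0r.
Qed.

Lemma admissible_sum (I : Type) (s : seq I) (F : I -> R * R -> R) :
  (forall i, admissible (F i)) -> admissible (fun w => \sum_(i <- s) F i w).
Proof.
move=> aF; elim: s => [|i s IH].
  by under eq_fun do rewrite big_nil; exact: admissible0.
by under eq_fun do rewrite big_cons; exact: admissibleD.
Qed.

Lemma admissible_fst : admissible (fun w => 1 - w.1).
Proof.
split.
  by case: (square_boundedB (square_bounded_cst 1) square_bounded_fst).
exists 1 => // w /unit_squareE [/andP[? ?] /andP[? ?]].
by rewrite ger0_norm ?subr_ge0 // mul1r lerDl subr_ge0.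
Qed.

Lemma admissible_snd : admissible (fun w => 1 - w.2).
Proof.
split.
  by case: (square_boundedB (square_bounded_cst 1) square_bounded_snd).
exists 1 => // w /unit_squareE [/andP[? ?] /andP[? ?]].
by rewrite ger0_norm ?subr_ge0 // mul1r lerDr subr_ge0.
Qed.

Lemma admissible_ext g h : admissible g -> g =1 h -> admissible h.
Proof. by move=> ag /funext <-. Qed.

Variable V : finType.
Implicit Types x y a b : V.

Lemma square_bounded_transition x y a b :
  square_bounded (fun w => transition x y w a b).
Proof.
rewrite /transition; case: (a == x); last case: (a == y); last exact: square_bounded_cst.
all: apply: square_boundedD; apply: square_boundedM; try exact: square_bounded_cst;
do ?[exact: square_bounded_cst|exact: square_bounded_fst
    |exact: square_bounded_snd|apply: square_boundedB].
Qed.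

Lemma admissible_transition x y a b :
  admissible (fun w => transition x y w a b - (b == a)%:R).
Proof.
rewrite /transition; case: eqP => [->|_].
  apply: (@admissible_ext (fun w => ((b == y)%:R - (b == x)%:R) * (1 - w.1))).
    exact/admissibleZ/admissible_fst.
  by move=> w; ring.
case: eqP => [->|_]; last by under eq_fun do rewrite subrr; exact: admissible0.
apply: (@admissible_ext (fun w => ((b == x)%:R - (b == y)%:R) * (1 - w.2))).
  exact/admissibleZ/admissible_snd.
by move=> w; ring.
Qed.

Lemma square_bounded_tensor x y k (a b : tuples V k) :
  square_bounded (fun w => tensor (transition x y w) a b).
Proof.
elim: k a b => [|k IH] a b /=; first exact: square_bounded_cst.
exact/square_boundedM/IH/square_bounded_transition.
Qed.

(* [p q - p0 q0 = (p - p0) q + p0 (q - q0)] *)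
Lemma admissible_tensor x y k (a b : tuples V k) :
  admissible (fun w => tensor (transition x y w) a b - (b == a)%:R).
Proof.
rewrite -tensor_delta; elim: k a b => [|k IH] a b /=.
  by under eq_fun do rewrite subrr; exact: admissible0.
apply: (@admissible_ext (fun w =>
    tensor (transition x y w) a.2 b.2 * (transition x y w a.1 b.1 - (b.1 == a.1)%:R) +
    (b.1 == a.1)%:R * (tensor (transition x y w) a.2 b.2 -
                       tensor (fun c d => (d == c)%:R) a.2 b.2))).
  apply: admissibleD; last exact/admissibleZ/IH.
  by apply: admissibleM; [exact: square_bounded_tensor|exact: admissible_transition].
by move=> w; ring.
Qed.

End Admissible.

(** * Real and imaginary parts, and polynomial functions *)

(** Covers [complex.Re] and [complex.Im] at once, as [cintegral] is defined by these two parts. *)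
Definition real_linear (R : realType) (P : R[i] -> R) :=
  (forall z z', P (z + z') = P z + P z') /\
  (forall (r : R) z, P (r%:C%C * z) = r * P z).

Lemma real_linear_Re (R : realType) : real_linear (@complex.Re R).
Proof. by split=> [[a b] [c d]|r [a b]] //=; rewrite mul0r subr0. Qed.

Lemma real_linear_Im (R : realType) : real_linear (@complex.Im R).
Proof. by split=> [[a b] [c d]|r [a b]] //=; rewrite mul0r addr0. Qed.

Lemma real_linear0 (R : realType) (P : R[i] -> R) : real_linear P -> P 0 = 0.
Proof. by case=> _ PZ; have := PZ 0 0; rewrite mulr0 mul0r. Qed.

Lemma real_linear_sum (R : realType) (P : R[i] -> R) (I : Type) (s : seq I)
    (F : I -> R[i]) : real_linear P ->
  P (\sum_(i <- s) F i) = \sum_(i <- s) P (F i).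
Proof.
by move=> lP; apply: (big_morph P lP.1); exact: real_linear0.
Qed.

Lemma complex_ext (R : realType) (z z' : R[i]) :
  complex.Re z = complex.Re z' -> complex.Im z = complex.Im z' -> z = z'.
Proof. by case: z z' => [a b] [c d] /= -> ->. Qed.

(** This is E_k. It forgets the order of the variables, so [phi] cannot be recovered from it in
    general. *)
Definition poly_function (R : realType) (V : finType) (k : nat)
    (phi : tuples V k -> R[i]) (eta : V -> R) : R[i] :=
  \sum_a (monomial eta a)%:C%C * phi a.

(** The jump changes only the weight at x, so the total mass stays 1 only if nothing moves; if it
    leaves the simplex, [insubd] returns the default [eta]. *)
Lemma insubd_jump_diag (R : realType) (V : finType) (x : V) (u v : R)
    (eta : simplex R V) : insubd eta (jump x x u v eta) = eta.
Proof.
apply/val_inj; rewrite val_insubd; case: ifP => // /andP[_ /eqP].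
case: eta => eta /= /andP[_ /eqP <-].
rewrite (bigD1 x) //= [in RHS](bigD1 x) //= !ffunE eqxx.
rewrite (eq_bigr eta) => [/addIr jx|z /negbTE zx]; last by rewrite ffunE zx.
by apply/ffunP => z; rewrite ffunE; case: eqVneq => [->|].
Qed.

(** * Integration against the measures and the matrix of the generator *)

Section Integrals.
Variables (R : realType) (V : finType) (beta : square_measures R V).
Hypothesis hA1 : assumption_A1 beta.
Implicit Types (x y : V) (g h : R * R -> R) (k : nat).

Definition square_integral x y g := \int[beta x y]_(w in unit_square R) g w.

Lemma admissible_integrable x y g : admissible g ->
  (beta x y).-integrable (unit_square R) (EFin \o g).
Proof.
have mS := @measurable_unit_square R.
move=> [mg [C C0 gC]].
apply: (@le_integrable _ _ _ _ _ mS _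
          (EFin \o fun w => C * ((1 - w.1) + (1 - w.2)))).
- exact/measurable_EFinP.
- by move=> w sw /=; rewrite lee_fin (le_trans (gC w sw)) // ler_norm.
have [mdef _] := admissibleD (admissible_fst R) (admissible_snd R).
have idef : (beta x y).-integrable (unit_square R)
    (EFin \o fun w => (1 - w.1) + (1 - w.2)).
  apply/integrableP; split; first exact/measurable_EFinP.
  apply: le_lt_trans (hA1 x y); rewrite le_eqVlt; apply/orP; left.
  apply/eqP; apply: eq_integral.
  by move=> w; rewrite inE => sw; rewrite /= ger0_norm ?deficit_ge0.
under [X in _.-integrable _ X]eq_fun do rewrite /= EFinM.
exact: integrableZl.
Qed.

Lemma square_integralD x y g h : admissible g -> admissible h ->
  square_integral x y (fun w => g w + h w) =
  square_integral x y g + square_integral x y h.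
Proof.
move=> ag ah; apply: RintegralD; first exact: measurable_unit_square.
  exact: admissible_integrable.
exact: admissible_integrable.
Qed.

Lemma square_integralZ x y c g : admissible g ->
  square_integral x y (fun w => c * g w) = c * square_integral x y g.
Proof.
move=> ag; apply: RintegralZl; first exact: measurable_unit_square.
exact: admissible_integrable.
Qed.

Lemma square_integral_sum x y (I : Type) (s : seq I) (F : I -> R * R -> R) :
  (forall i, admissible (F i)) ->
  square_integral x y (fun w => \sum_(i <- s) F i w) =
  \sum_(i <- s) square_integral x y (F i).
Proof.
move=> aF; elim: s => [|i s IH].
  rewrite big_nil /square_integral; under eq_fun do rewrite big_nil.
  by rewrite /Rintegral integral0.
rewrite big_cons -IH -square_integralD //; last exact: admissible_sum.
by congr square_integral; apply/funext => w; rewrite big_cons.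
Qed.

Lemma le_square_integral x y g h : admissible g -> admissible h ->
  (forall w, unit_square R w -> g w <= h w) ->
  square_integral x y g <= square_integral x y h.
Proof.
move=> ag ah gh; apply: le_Rintegral => //; first exact: measurable_unit_square.
  exact: admissible_integrable.
exact: admissible_integrable.
Qed.

Lemma square_integral_ge0 x y g : (forall w, unit_square R w -> 0 <= g w) ->
  0 <= square_integral x y g.
Proof. by move=> g0; apply: Rintegral_ge0 => w /g0. Qed.

Lemma eq_square_integral x y g h : (forall w, unit_square R w -> g w = h w) ->
  square_integral x y g = square_integral x y h.
Proof. by move=> gh; apply: eq_Rintegral => w; rewrite inE => /gh. Qed.

Lemma sym_integralE x y (g : R -> R -> R) :
  sym_integral beta x y g =
  square_integral x y (fun w => g w.1 w.2) +
  square_integral y x (fun w => g w.2 w.1).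
Proof. by []. Qed.

Hypothesis beta_diag : forall x, beta x x (unit_square R) = 0%E.

Lemma square_integral_diag x g : admissible g -> square_integral x x g = 0.
Proof.
move=> [mg _]; rewrite /square_integral /Rintegral null_set_integral //.
- exact: measurable_unit_square.
- exact/measurable_EFinP.
Qed.

(** This is M_k. The identity is subtracted under the integral because the tensor power alone need
    not be integrable against an infinite measure. *)
Definition moment_matrix k (a b : tuples V k) : R :=
  \sum_x \sum_y
    square_integral x y (fun w => tensor (transition x y w) a b - (b == a)%:R).

(** The coefficients [c] are arbitrary so that this serves both the action on polynomials and the
    pairing with the functional omega. *)
Lemma moment_matrix_sum k (c : tuples V k -> tuples V k -> R) :
  \sum_a \sum_b c a b * moment_matrix a b =
  \sum_x \sum_y square_integral x y (fun w =>
    \sum_a \sum_b c a b * (tensor (transition x y w) a b - (b == a)%:R)).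
Proof.
have adm x y a b := admissible_tensor R x y a b.
have intE x y : square_integral x y (fun w =>
    \sum_a \sum_b c a b * (tensor (transition x y w) a b - (b == a)%:R)) =
  \sum_a \sum_b c a b *
    square_integral x y (fun w => tensor (transition x y w) a b - (b == a)%:R).
  rewrite square_integral_sum => [|a]; last first.
    by apply: admissible_sum => b; exact/admissibleZ/adm.
  apply: eq_bigr => a _; rewrite square_integral_sum => [|b]; last exact/admissibleZ/adm.
  by apply: eq_bigr => b _; exact/square_integralZ/adm.
rewrite pair_bigA [RHS]pair_bigA /=.
under eq_bigr do rewrite /moment_matrix pair_bigA mulr_sumr /=.
rewrite exchange_big; apply: eq_bigr => p _ /=.
by rewrite intE pair_bigA.
Qed.

Lemma poly_function_jump k (phi : tuples V k -> R[i]) P x y w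
    (eta : simplex R V) : real_linear P -> x != y -> unit_square R w ->
  P (poly_function phi (insubd eta (jump x y w.1 w.2 eta)) -
     poly_function phi eta) =
  \sum_a \sum_b monomial eta a * P (phi b) *
    (tensor (transition x y w) a b - (b == a)%:R).
Proof.
move=> lP xy /unit_squareE [w1 w2]; have [PD PZ] := lP.
have PB z z' : P (z - z') = P z - P z'.
  have -> : - z' = (-1)%:C%C * z' by rewrite rmorphN1 mulN1r.
  by rewrite PD PZ mulN1r.
rewrite PB !real_linear_sum //; apply/eqP; rewrite subr_eq; apply/eqP.
have -> : val (insubd eta (jump x y w.1 w.2 eta)) = jump x y w.1 w.2 eta.
  by rewrite insubdK //; exact: jump_in_simplex.
under eq_bigr => b _.
  rewrite PZ (eq_monomial b (fun z => jump_transition w eta z xy)) monomial_act mulr_suml.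
  over.
rewrite exchange_big -big_split; apply: eq_bigr => a _ /=; rewrite PZ.
under [X in _ = X + _]eq_bigr do rewrite mulrBr.
rewrite sumrB -[LHS]addr0 -addrA; congr (_ + _); first by apply: eq_bigr => b _; ring.
rewrite (bigD1 a) //= eqxx mulr1 big1 ?addr0 ?addNr // => b /negbTE ->.
by rewrite mulr0.
Qed.

Lemma generator_poly_function k (phi : tuples V k -> R[i]) (eta : simplex R V) :
  generator beta (fun eta : simplex R V => poly_function phi eta) eta =
  poly_function (fun a => \sum_b (moment_matrix a b)%:C%C * phi b) eta.
Proof.
have main P : real_linear P ->
    \sum_x \sum_y (\int[beta x y]_(w in unit_square R)
      P (poly_function phi (insubd eta (jump x y w.1 w.2 eta)) -
         poly_function phi eta)) =
    P (poly_function (fun a => \sum_b (moment_matrix a b)%:C%C * phi b) eta).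
  move=> lP; have [_ PZ] := lP.
  rewrite real_linear_sum //; under [RHS]eq_bigr => a _.
    rewrite PZ real_linear_sum // mulr_sumr.
    under eq_bigr do rewrite PZ mulrCA mulrC.
    over.
  rewrite moment_matrix_sum; apply: eq_bigr => x _; apply: eq_bigr => y _.
  (* On the diagonal the two sides vanish for different reasons: the matrix side because [beta x x]
     is null on the square, the generator side because the jump does not move [eta]. *)
  have [<-|xy] := eqVneq x y; last first.
    by apply: eq_square_integral => w sw; exact: poly_function_jump.
  rewrite square_integral_diag; last first.
    apply: admissible_sum => a; apply: admissible_sum => b.
    exact/admissibleZ/admissible_tensor.
  rewrite /Rintegral integral0_eq // => w _; rewrite insubd_jump_diag subrr.
  by rewrite real_linear0.
apply: complex_ext.
  rewrite -main; last exact: real_linear_Re.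
  rewrite /generator real_linear_sum; last exact: real_linear_Re.
  by apply: eq_bigr => x _; rewrite real_linear_sum //; exact: real_linear_Re.
rewrite -main; last exact: real_linear_Im.
rewrite /generator real_linear_sum; last exact: real_linear_Im.
by apply: eq_bigr => x _; rewrite real_linear_sum //; exact: real_linear_Im.
Qed.

End Integrals.

(** * Linear functionals on a quotient by an invariant subspace *)

(** Take [B] of maximal rank among the matrices with row space inside [U]: a vector of [U] outside
    this row space could be adjoined and would raise the rank. *)
Lemma subspace_matrix (F : fieldType) n (U : 'rV[F]_n -> Prop) :
  U 0 -> (forall c u v, U u -> U v -> U (c *: u + v)) ->
  exists B : 'M[F]_n, forall u, U u <-> (u <= B)%MS.
Proof.
move=> U0 UL.
pose P r := `[< exists B : 'M[F]_n,
  (forall u : 'rV_n, (u <= B)%MS -> U u) /\ \rank B = r >].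
have exP : exists r, P r.
  exists 0%N; apply/asboolP; exists 0; split; last exact: mxrank0.
  by move=> u; rewrite submx0 => /eqP ->.
have bndP r : P r -> (r <= n)%N.
  by move=> /asboolP [B [_ <-]]; exact: rank_leq_row.
case: (ex_maxnP exP bndP) => r /asboolP [B [BU rB]] rmax.
exists B => u; split; last exact: BU.
move=> Uu; apply: contrapT => /negP uB.
have Bu : (B < B + u)%MS.
  by rewrite /ltmx addsmxSl /=; apply: contra uB; apply: submx_trans; exact: addsmxSr.
have : P (\rank (B + u)%MS).
  apply/asboolP; exists (B + u)%MS; split=> // v /sub_addsmxP [[x y] /= ->].
  rewrite addrC [y]mx11_scalar mul_scalar_mx; apply: UL => //.
  exact/BU/submxMl.
by move/rmax; rewrite leqNgt -rB; move: Bu; rewrite ltmxErank => /andP[_ ->].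
Qed.

(* The endomorphism of the quotient by U induced by A is not injective, hence
   not surjective. *)
Lemma quotient_annihilator (F : fieldType) n (A : 'M[F]_n)
    (U : 'rV[F]_n -> Prop) (phi : 'rV[F]_n) :
  U 0 -> (forall c u v, U u -> U v -> U (c *: u + v)) ->
  (forall u, U u -> U (u *m A)) -> ~ U phi -> U (phi *m A) ->
  exists omega : 'cV[F]_n,
    [/\ omega != 0, forall u, U u -> u *m omega = 0 & A *m omega = 0].
Proof.
move=> U0 UL UA Uphi UphiA.
have [B UB] := subspace_matrix U0 UL.
pose C := cokermx B.
have BC u : U u -> u *m C = 0 by move/UB; rewrite submxE => /eqP.
have kB : (B <= kermx (A *m C))%MS.
  apply/row_subP => i; apply/sub_kermxP; rewrite mulmxA; apply/BC/UA/UB.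
  exact: row_sub.
have kphi : (phi <= kermx (A *m C))%MS.
  by apply/sub_kermxP; rewrite mulmxA; exact: BC.
have ltBk : (\rank B < \rank (kermx (A *m C)))%N.
  have : (B < kermx (A *m C))%MS.
    rewrite /ltmx kB /=; apply/negP => /(submx_trans kphi) phiB.
    exact/Uphi/UB.
  by rewrite ltmxErank => /andP[].
(* The kernel of [A *m C] is larger than that of [C], so its rank is smaller, and some [c] is killed
   by the transpose of [A *m C] but not by that of [C]. Then [C *m c^T] is nonzero, vanishes on [U]
   because [C] does, and is killed by [A]. *)
have : ~~ (kermx (A *m C)^T <= kermx C^T)%MS.
  apply/negP => /mxrankS; rewrite !mxrank_ker !mxrank_tr mxrank_coker.
  by rewrite subKn ?rank_leq_row // leqNgt -mxrank_ker ltBk.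
case/row_subPn => i; set c := row i _ => cC.
have cAC : c *m (A *m C)^T = 0 by apply/sub_kermxP; exact: row_sub.
exists (C *m c^T); split.
- apply: contra cC => /eqP e; apply/sub_kermxP.
  by apply: trmx_inj; rewrite trmx_mul trmxK e trmx0.
- by move=> u /BC e; rewrite mulmxA e mul0mx.
- by rewrite mulmxA; apply: trmx_inj; rewrite trmx_mul trmxK cAC trmx0.
Qed.

Lemma quotient_annihilator_fun (F : fieldType) (T : finType) (A : T -> T -> F)
    (U : (T -> F) -> Prop) (phi : T -> F) :
  U (fun=> 0) ->
  (forall c u v, U u -> U v -> U (fun t => c * u t + v t)) ->
  (forall u, U u -> U (fun a => \sum_b A a b * u b)) ->
  ~ U phi -> U (fun a => \sum_b A a b * phi b) ->
  exists omega : T -> F,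
    [/\ exists t, omega t != 0,
        forall u, U u -> \sum_t omega t * u t = 0 &
        forall b, \sum_a omega a * A a b = 0].
Proof.
move=> U0 UL UA Uphi UphiA.
have sumT (G : 'I_#|T| -> F) : \sum_i G i = \sum_t G (enum_rank t).
  by rewrite (reindex (@enum_rank T)) //; apply: onW_bij; exact: enum_rank_bij.
pose fn (u : 'rV[F]_#|T|) t := u 0 (enum_rank t).
pose row (f : T -> F) : 'rV[F]_#|T| := \row_i f (enum_val i).
have rowK f : fn (row f) = f by apply/funext => t; rewrite /fn mxE enum_rankK.
(* The indices are transposed because row vectors are multiplied on the right, whereas [A] acts on
   functions from the left. *)
pose M := \matrix_(i < #|T|, j < #|T|) A (enum_val j) (enum_val i).
have fnM u : fn (u *m M) = (fun a => \sum_b A a b * fn u b).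
  apply/funext => a; rewrite /fn mxE sumT; apply: eq_bigr => b _.
  by rewrite mxE !enum_rankK mulrC.
have [|||||omega [omega0 omegaU omegaA]] :=
    @quotient_annihilator F _ M (U \o fn) (row phi).
- by rewrite /= (_ : fn 0 = fun=> 0) //; apply/funext => t; rewrite /fn mxE.
- move=> c u v Uu Uv /=.
  rewrite (_ : fn _ = fun t => c * fn u t + fn v t); first exact: UL.
  by apply/funext => t; rewrite /fn !mxE.
- by move=> u Uu; rewrite /= fnM; exact: UA.
- by rewrite /= rowK.
- by rewrite /= fnM rowK.
exists (fun t => omega (enum_rank t) 0); split.
- move: omega0; apply: contraNP => /forallNP om0; apply/eqP/matrixP => i j.
  rewrite ord1 mxE -(enum_valK i); apply/eqP; apply: contrapT => /negP.
  exact: om0.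
- move=> u Uu; have /omegaU : (U \o fn) (row u) by rewrite /= rowK.
  move=> /matrixP /(_ 0 0); rewrite !mxE sumT => e; rewrite -[RHS]e.
  by apply: eq_bigr => t _; rewrite mxE enum_rankK mulrC.
- move=> b; have /matrixP /(_ (enum_rank b) 0) := omegaA.
  rewrite !mxE sumT => e; rewrite -[RHS]e; apply: eq_bigr => a _.
  by rewrite mxE !enum_rankK mulrC.
Qed.

(** * Polynomials of degree at most k as homogeneous ones on the simplex *)

Section PolynomialFunctions.
Variables (R : realType) (V : finType).
Implicit Types (k : nat) (x : V) (eta : simplex R V) (f g : simplex R V -> R[i]).

(** Since the weights sum to 1, any monomial of lower degree can be padded to degree k; k is thus
    only an upper bound on the degree of [f]. *)
Definition homogeneous k f :=
  exists phi : tuples V k -> R[i], forall eta, f eta = poly_function phi eta.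

Lemma eq_homogeneous k f g : f =1 g -> homogeneous k f -> homogeneous k g.
Proof. by move=> /funext ->. Qed.

Lemma simplex_sum eta : \sum_x eta x = 1.
Proof. by case: eta => eta /= /andP[_ /eqP]. Qed.

Lemma sum_tuples0 (W : nmodType) (F : tuples V 0 -> W) : \sum_a F a = F tt.
Proof. by rewrite (big_pred1 tt) //; case. Qed.

Lemma poly_functionS k (phi : tuples V k.+1 -> R[i]) (eta : V -> R) :
  poly_function phi eta =
  \sum_x (eta x)%:C%C * poly_function (fun a => phi (x, a)) eta.
Proof.
rewrite /poly_function sum_tuplesS; apply: eq_bigr => x _.
by rewrite mulr_sumr; apply: eq_bigr => a _ /=; rewrite rmorphM mulrA.
Qed.

Lemma homogeneous_cst c : homogeneous 0 (fun=> c).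
Proof.
by exists (fun=> c) => eta; rewrite /poly_function sum_tuples0 /= mul1r.
Qed.

(** A variable on which the coefficients do not depend contributes the factor sum of [eta], which is
    1. *)
Lemma poly_function_pullback k (phi : tuples V k -> R[i]) eta :
  poly_function (fun a : tuples V k.+1 => phi a.2) eta = poly_function phi eta.
Proof.
rewrite poly_functionS /= -mulr_suml -rmorph_sum /=.
by rewrite simplex_sum mul1r.
Qed.

Lemma homogeneousS k f : homogeneous k f -> homogeneous k.+1 f.
Proof.
move=> [phi fE]; exists (fun a : tuples V k.+1 => phi a.2) => eta.
by rewrite poly_function_pullback.
Qed.

Lemma homogeneous_le k l f : (k <= l)%N -> homogeneous k f -> homogeneous l f.
Proof.
move=> /subnK <-; elim: (l - k)%N => [//|m IH] hf.
by rewrite addSn; exact/homogeneousS/IH.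
Qed.

Lemma homogeneous_mulX k x f : homogeneous k f ->
  homogeneous k.+1 (fun eta => (eta x)%:C%C * f eta).
Proof.
move=> [phi fE]; exists (fun a : tuples V k.+1 => (a.1 == x)%:R * phi a.2) => eta.
rewrite poly_functionS (bigD1 x) //= big1 => [|y /negbTE yx].
  rewrite addr0 fE; congr (_ * _); apply: eq_bigr => a _ /=.
  by rewrite eqxx mul1r.
rewrite /poly_function big1 ?mulr0 // => a _ /=.
by rewrite yx mul0r mulr0.
Qed.

Lemma homogeneous_mulXn k x m f : homogeneous k f ->
  homogeneous (m + k) (fun eta => (eta x)%:C%C ^+ m * f eta).
Proof.
move=> hf; elim: m => [|m IH].
  by under eq_fun do rewrite expr0 mul1r.
under eq_fun do rewrite exprS -mulrA.
by rewrite addSn; exact: homogeneous_mulX.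
Qed.

Lemma homogeneous_prodX (I : Type) (s : seq I) (e : I -> nat) (z : I -> V) :
  homogeneous (\sum_(i <- s) e i)
    (fun eta => \prod_(i <- s) (eta (z i))%:C%C ^+ e i).
Proof.
elim: s => [|i s IH].
  rewrite big_nil; apply: eq_homogeneous (homogeneous_cst 1) => eta.
  by rewrite big_nil.
rewrite big_cons; apply: eq_homogeneous (homogeneous_mulXn (z i) (e i) IH) => eta.
by rewrite big_cons.
Qed.

Lemma homogeneous_linear k c f g : homogeneous k f -> homogeneous k g ->
  homogeneous k (fun eta => c * f eta + g eta).
Proof.
move=> [phi fE] [psi gE]; exists (fun a => c * phi a + psi a) => eta.
rewrite fE gE /poly_function mulr_sumr -big_split /=.
by apply: eq_bigr => a _; ring.
Qed.

Lemma homogeneous_comb k (I : eqType) (s : seq I) (c : I -> R[i])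
    (f : I -> simplex R V -> R[i]) :
  (forall i, i \in s -> homogeneous k (f i)) ->
  homogeneous k (fun eta => \sum_(i <- s) c i * f i eta).
Proof.
elim: s => [|i s IH] hf.
  under eq_fun do rewrite big_nil.
  exact/(homogeneous_le (leq0n k))/homogeneous_cst.
under eq_fun do rewrite big_cons.
apply: homogeneous_linear; first exact/hf/mem_head.
by apply: IH => j js; apply: hf; rewrite inE js orbT.
Qed.

Lemma poly_functions_homogeneous k f :
  poly_functions k f -> homogeneous k f.
Proof.
move=> [p [pk fE]].
have -> : f = fun eta => \sum_(m <- msupp p) mcoeff m p *
    \prod_(i < #|V|) (eta (enum_val i))%:C%C ^+ m i.
  by apply/funext => eta; rewrite fE mevalE.
apply: homogeneous_comb => m mp.
have mk : (mdeg m <= k)%N by rewrite -ltnS (leq_trans (msize_mdeg_lt mp)).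
apply: homogeneous_le mk _; rewrite mdegE.
exact: homogeneous_prodX.
Qed.

Fixpoint tuple_mnm k : tuples V k -> multinom #|V| :=
  if k is k'.+1 return tuples V k -> multinom #|V| then
    fun a => mnm_add (mnm1 (enum_rank a.1)) (tuple_mnm a.2)
  else fun=> mnm0.

Lemma mdeg_tuple_mnm k (a : tuples V k) : mdeg (tuple_mnm a) = k.
Proof.
elim: k a => [|k IH] a /=; first exact: mdeg0.
by rewrite mdegD mdeg1 IH.
Qed.

Lemma meval_tuple_mnm k (a : tuples V k) (eta : V -> R) :
  meval (fun i => (eta (enum_val i))%:C%C) (mpolyX R[i] (tuple_mnm a)) =
  (monomial eta a)%:C%C.
Proof.
elim: k a => [|k IH] a /=; first by rewrite mpolyX0 meval1.
by rewrite mpolyXD mevalM mevalXU IH enum_rankK rmorphM.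
Qed.

Lemma homogeneous_poly_functions k f :
  homogeneous k f -> poly_functions k f.
Proof.
move=> [phi fE].
exists (\sum_a phi a *: mpolyX R[i] (tuple_mnm a)); split.
  apply: (big_ind (fun p : mpoly #|V| R[i] => (msize p <= k.+1)%N)).
  - by rewrite msize0.
  - by move=> p q pk qk; rewrite (leq_trans (msizeD_le _ _)) // geq_max pk.
  - by move=> a _; rewrite (leq_trans (msizeZ_le _ _)) // msizeX mdeg_tuple_mnm.
move=> eta; rewrite fE /poly_function raddf_sum /=; apply: eq_bigr => a _.
by rewrite mevalZ meval_tuple_mnm mulrC.
Qed.

End PolynomialFunctions.

(** * The transposed eigenvector *)

Section EigenFunctional.
Variables (R : realType) (V : finType) (beta : square_measures R V).
Hypothesis hA1 : assumption_A1 beta.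
Hypothesis beta_diag : forall x, beta x x (unit_square R) = 0%E.
Implicit Types (k : nat) (x y : V) (psi : V -> R).

Local Notation eigenvalue_degree k lambda :=
  (eigenvalue_on (fun f eta => - generator beta f eta)
     (@poly_functions R V k) lambda).

Lemma poly_function_linear k (c : R[i]) (u v : tuples V k -> R[i]) (eta : V -> R) :
  poly_function (fun a => c * u a + v a) eta =
  c * poly_function u eta + poly_function v eta.
Proof.
rewrite /poly_function mulr_sumr -big_split /=.
by apply: eq_bigr => a _; ring.
Qed.

(** Stated through the function represented, so that it includes all coefficients representing
    zero. *)
Definition lower_degree k (u : tuples V k.+1 -> R[i]) :=
  exists phi : tuples V k -> R[i],
    forall eta : simplex R V, poly_function u eta = poly_function phi eta.

(** In the quotient by [lower_degree], the class of [phi] is killed by the matrix plus [lambda],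
    since the result represents the zero function. It is nonzero, as otherwise [f] itself would be
    an eigenfunction of degree at most k. *)
Lemma eigen_functional k lambda :
  eigenvalue_degree k.+1 lambda -> ~ eigenvalue_degree k lambda ->
  exists omega : tuples V k.+1 -> R[i],
    [/\ exists t, omega t != 0,
        forall u, lower_degree u -> \sum_a omega a * u a = 0 &
        forall u, \sum_a omega a * (\sum_b (moment_matrix beta a b)%:C%C * u b) =
                  - lambda * \sum_a omega a * u a].
Proof.
move=> [f [fk f0 fE]] nlow.
have [phi fphi] := poly_functions_homogeneous fk.
pose act l (u : tuples V l -> R[i]) a :=
  \sum_b ((moment_matrix beta a b)%:C%C + lambda * (b == a)%:R) * u b.
have actE l (u : tuples V l -> R[i]) a :
    act l u a = lambda * u a + \sum_b (moment_matrix beta a b)%:C%C * u b.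
  rewrite /act; under eq_bigr do rewrite mulrDl; rewrite big_split /= addrC.
  congr (_ + _); rewrite (bigD1 a) //= eqxx mulr1 big1 ?addr0 // => b /negbTE ->.
  by rewrite mulr0 mul0r.
have actP l (u : tuples V l -> R[i]) (eta : simplex R V) :
    poly_function (act l u) eta =
    lambda * poly_function u eta +
    generator beta (fun e : simplex R V => poly_function u e) eta.
  rewrite (generator_poly_function hA1 beta_diag) -poly_function_linear.
  by congr poly_function; apply/funext => a; rewrite actE.
have [|||||omega [omega0 omegaU omegaA]] := @quotient_annihilator_fun R[i]
    (tuples V k.+1)
    (fun a b => (moment_matrix beta a b)%:C%C + lambda * (b == a)%:R)
    (@lower_degree k) phi.
- exists (fun=> 0) => eta.
  by rewrite /poly_function !big1 // => a _; rewrite mulr0.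
- move=> c u v [u' uE] [v' vE]; exists (fun a => c * u' a + v' a) => eta.
  by rewrite !poly_function_linear uE vE.
(* The generator sees only the function represented, so the lower-degree representative [u'] can be
   moved in place of [u]. *)
- move=> u [u' uE]; exists (act k u') => eta; rewrite (actP k.+1 u) actP uE.
  congr (_ + _ ); congr (generator beta _ _).
  by apply/funext => e; exact: uE.
- move=> [phi' phiE]; apply: nlow; exists f; split=> //.
  apply: homogeneous_poly_functions; exists phi' => eta.
  by rewrite fphi phiE.
- exists (fun=> 0) => eta; rewrite (actP k.+1 phi).
  rewrite -fphi (_ : (fun e : simplex R V => _) = f); last first.
    by apply/funext => e; rewrite fphi.
  move/(congr1 (fun g => g eta)): fE => /= <-.
  by rewrite addNr /poly_function big1 // => a _; rewrite mulr0.
exists omega; split=> // u; apply/eqP; rewrite mulNr -addr_eq0 addrC; apply/eqP.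
rewrite mulr_sumr -big_split /=.
transitivity (\sum_a omega a * act k.+1 u a).
  by apply: eq_bigr => a _; rewrite actE mulrDr mulrCA.
under eq_bigr do rewrite /act mulr_sumr.
rewrite exchange_big big1 // => b _.
under eq_bigr do rewrite mulrA.
by rewrite -mulr_suml omegaA mul0r.
Qed.

End EigenFunctional.

(** * The bilinear form of the functional and its maximum principle *)

Section Form.
Variables (R : realType) (V : finType) (k : nat) (omega : tuples V k.+2 -> R[i]).
Implicit Types (x y : V) (psi : V -> R) (Psi : tuples V k -> R[i]).
Implicit Types (K : V -> V -> R) (w : R * R).
Local Open Scope complex_scope.
Local Notation normc := Normc.normc.

Definition pair_form psi1 psi2 (a : tuples V k) : R[i] :=
  \sum_x \sum_y (psi1 x * psi2 y)%:C * omega (x, (y, a)).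

(** By duality of the l^1 and sup norms, this is the maximum over |Psi| <= 1 of the modulus of omega
    at psi1 (x) psi2 (x) Psi. *)
Definition form_norm psi1 psi2 : R := \sum_a normc (pair_form psi1 psi2 a).

Definition pure psi1 psi2 Psi (t : tuples V k.+2) : R[i] :=
  (psi1 t.1)%:C * ((psi2 t.2.1)%:C * Psi t.2.2).

Definition act K psi x := \sum_y K x y * psi y.

Definition tensor_act K Psi a := \sum_b (tensor K a b)%:C * Psi b.

Lemma sum_pure psi1 psi2 Psi :
  \sum_t omega t * pure psi1 psi2 Psi t = \sum_a pair_form psi1 psi2 a * Psi a.
Proof.
rewrite sum_tuplesSS; under eq_bigr do rewrite exchange_big /=.
rewrite exchange_big /=; apply: eq_bigr => a _.
rewrite mulr_suml; apply: eq_bigr => x _; rewrite mulr_suml.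
by apply: eq_bigr => y _; rewrite /pure /= rmorphM /=; ring.
Qed.

Lemma tensor_act_pure K psi1 psi2 Psi (t : tuples V k.+2) :
  \sum_b (tensor K t b)%:C * pure psi1 psi2 Psi b =
  pure (act K psi1) (act K psi2) (tensor_act K Psi) t.
Proof.
case: t => x [y a]; rewrite sum_tuplesSS /pure /act /= rmorph_sum mulr_suml.
apply: eq_bigr => x' _; rewrite rmorph_sum mulr_suml mulr_sumr.
apply: eq_bigr => y' _; rewrite !mulr_sumr; apply: eq_bigr => b _ /=.
by rewrite !rmorphM /=; ring.
Qed.

Lemma normc_real (r : R) : normc r%:C = `|r|.
Proof. by rewrite /= expr0n addr0 sqrtr_sqr. Qed.

Lemma normc_ge0 (z : R[i]) : 0 <= normc z.
Proof. by case: z => a b; exact: sqrtr_ge0. Qed.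

Lemma Re_le_normc (z : R[i]) : complex.Re z <= normc z.
Proof.
case: z => a b /=; rewrite (le_trans (ler_norm a)) // -sqrtr_sqr ler_sqrt.
  by rewrite lerDl sqr_ge0.
by rewrite addr_ge0 ?sqr_ge0.
Qed.

Lemma le_normc_sum (I : Type) (s : seq I) (F : I -> R[i]) :
  normc (\sum_(i <- s) F i) <= \sum_(i <- s) normc (F i).
Proof.
elim: s => [|i s IH]; first by rewrite !big_nil Normc.normc0.
by rewrite !big_cons (le_trans (le_normcD _ _)) // lerD2l.
Qed.

Lemma normc_phase (z : R[i]) : exists2 c, normc c <= 1 & z * c = (normc z)%:C.
Proof.
have [->|z0] := eqVneq z 0.
  by exists 0; rewrite ?Normc.normc0 ?mul0r.
have nz : normc z != 0 by apply: contra z0 => /eqP /Normc.eq0_normc ->.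
exists ((normc z)%:C / z); last by rewrite mulrC divfK.
by rewrite Normc.normcM Normc.normcV normc_real ger0_norm ?normc_ge0 ?divff.
Qed.

Lemma form_le_norm psi1 psi2 Psi : (forall a, normc (Psi a) <= 1) ->
  complex.Re (\sum_a pair_form psi1 psi2 a * Psi a) <= form_norm psi1 psi2.
Proof.
move=> Psi1; rewrite (le_trans (Re_le_normc _)) // (le_trans (le_normc_sum _ _)) //.
by apply: ler_sum => a _; rewrite Normc.normcM ler_piMr ?normc_ge0.
Qed.

Lemma form_norm_attained psi1 psi2 : exists2 Psi, (forall a, normc (Psi a) <= 1) &
  \sum_a pair_form psi1 psi2 a * Psi a = (form_norm psi1 psi2)%:C.
Proof.
have /choice [Psi PsiE] : forall a, exists c,
    normc c <= 1 /\ pair_form psi1 psi2 a * c = (normc (pair_form psi1 psi2 a))%:C.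
  by move=> a; have [c ? ?] := normc_phase (pair_form psi1 psi2 a); exists c.
exists Psi => [a|]; first by case: (PsiE a).
by rewrite /form_norm rmorph_sum; apply: eq_bigr => a _; case: (PsiE a).
Qed.

Lemma tensor_act_norm K Psi a :
  (forall x y, 0 <= K x y) -> (forall x, \sum_y K x y = 1) ->
  (forall b, normc (Psi b) <= 1) -> normc (tensor_act K Psi a) <= 1.
Proof.
move=> K0 K1 Psi1; rewrite -(tensor_row_sum a K1) (le_trans (le_normc_sum _ _)) //.
apply: ler_sum => b _; have t0 := tensor_ge0 a b K0.
by rewrite Normc.normcM normc_real ger0_norm // ler_piMr.
Qed.

Lemma form_linearl c c' psi psi' phi a :
  pair_form (fun x => c * psi x + c' * psi' x) phi a =
  c%:C * pair_form psi phi a + c'%:C * pair_form psi' phi a.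
Proof.
rewrite /pair_form !mulr_sumr -big_split /=; apply: eq_bigr => x _.
rewrite !mulr_sumr -big_split /=; apply: eq_bigr => y _.
by rewrite !(rmorphM, rmorphD) /=; ring.
Qed.

Lemma form_linearr c c' psi psi' phi a :
  pair_form phi (fun x => c * psi x + c' * psi' x) a =
  c%:C * pair_form phi psi a + c'%:C * pair_form phi psi' a.
Proof.
rewrite /pair_form !mulr_sumr -big_split /=; apply: eq_bigr => x _.
rewrite !mulr_sumr -big_split /=; apply: eq_bigr => y _.
by rewrite !(rmorphM, rmorphD) /=; ring.
Qed.

Lemma form_delta x y a :
  pair_form (fun z => (z == x)%:R) (fun z => (z == y)%:R) a = omega (x, (y, a)).
Proof.
rewrite /pair_form (bigD1 x) //= (bigD1 y) //= !eqxx mulr1 mul1r.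
rewrite big1 ?addr0 => [|z /negbTE ->]; last by rewrite mulr0 mul0r.
rewrite big1 ?addr0 // => z /negbTE ->; rewrite big1 // => ? _.
by rewrite !mul0r.
Qed.

Hypothesis omegaU : forall u, lower_degree u -> \sum_a omega a * u a = 0.

Lemma lower_degree_cstl psi Psi : lower_degree (pure (fun=> 1) psi Psi).
Proof.
exists (fun a : tuples V k.+1 => (psi a.1)%:C * Psi a.2) => eta.
rewrite -[RHS]poly_function_pullback; apply: eq_bigr => t _; congr (_ * _).
by rewrite /pure mul1r.
Qed.

Lemma lower_degree_cstr psi Psi : lower_degree (pure psi (fun=> 1) Psi).
Proof.
exists (fun a : tuples V k.+1 => (psi a.1)%:C * Psi a.2) => eta.
rewrite !poly_functionS; apply: eq_bigr => x _; congr (_ * _).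
rewrite -[RHS]poly_function_pullback; apply: eq_bigr => t _; congr (_ * _).
by rewrite /pure /= mul1r.
Qed.

Let sum_delta_tuples (h : tuples V k -> R[i]) a :
  \sum_b h b * (b == a)%:R = h a.
Proof.
rewrite (bigD1 a) //= eqxx mulr1 big1 ?addr0 // => b /negbTE ->.
by rewrite mulr0.
Qed.

(** Testing the functional with the indicator of [a] as Psi isolates a single entry of the form. *)
Lemma form_cstl psi a : pair_form (fun=> 1) psi a = 0.
Proof.
rewrite -(sum_delta_tuples (pair_form _ _)) -sum_pure.
exact/omegaU/lower_degree_cstl.
Qed.

Lemma form_cstr psi a : pair_form psi (fun=> 1) a = 0.
Proof.
rewrite -(sum_delta_tuples (pair_form _ _)) -sum_pure.
exact/omegaU/lower_degree_cstr.
Qed.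

Lemma form_norm_affine m s psi m' s' psi' : 0 <= s -> 0 <= s' ->
  form_norm (fun x => m + s * psi x) (fun x => m' + s' * psi' x) =
  s * s' * form_norm psi psi'.
Proof.
move=> s0 s'0; rewrite /form_norm mulr_sumr; apply: eq_bigr => a _.
have -> : (fun x => m + s * psi x) = (fun x => m * 1 + s * psi x).
  by apply/funext => x; rewrite mulr1.
have -> : (fun x => m' + s' * psi' x) = (fun x => m' * 1 + s' * psi' x).
  by apply/funext => x; rewrite mulr1.
rewrite form_linearl form_linearr (form_linearr _ _ (fun=> 1)).
rewrite !form_cstl !form_cstr !mulr0 !add0r mulr0 add0r.
by rewrite !Normc.normcM !normc_real !ger0_norm // mulrA.
Qed.

Variables (beta : square_measures R V) (lambda : R[i]).
Hypothesis hA1 : assumption_A1 beta.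
Hypothesis omegaM : forall u,
  \sum_a omega a * (\sum_b (moment_matrix beta a b)%:C * u b) =
  - lambda * \sum_a omega a * u a.

Definition form_increment psi1 psi2 Psi x y w : R :=
  complex.Re (\sum_a pair_form (act (transition x y w) psi1)
                          (act (transition x y w) psi2) a *
                     tensor_act (transition x y w) Psi a) -
  complex.Re (\sum_a pair_form psi1 psi2 a * Psi a).

Lemma form_incrementE psi1 psi2 Psi x y w :
  \sum_a \sum_b complex.Re (omega a * pure psi1 psi2 Psi b) *
    (tensor (transition x y w) a b - (b == a)%:R) =
  form_increment psi1 psi2 Psi x y w.
Proof.
have lR := real_linear_Re R.
rewrite /form_increment -!sum_pure !real_linear_sum // -sumrB.
apply: eq_bigr => a _.
under eq_bigr do rewrite mulrBr.
rewrite sumrB; congr (_ - _); last first.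
  rewrite (bigD1 a) //= eqxx mulr1 big1 ?addr0 // => b /negbTE ->.
  by rewrite mulr0.
rewrite -tensor_act_pure mulr_sumr real_linear_sum //; apply: eq_bigr => b _.
by rewrite [in RHS]mulrCA lR.2 mulrC.
Qed.

Lemma admissible_form_increment psi1 psi2 Psi x y :
  admissible (form_increment psi1 psi2 Psi x y).
Proof.
apply: (@admissible_ext R (fun w => \sum_a \sum_b
    complex.Re (omega a * pure psi1 psi2 Psi b) *
    (tensor (transition x y w) a b - (b == a)%:R))).
  apply: admissible_sum => a; apply: admissible_sum => b.
  exact/admissibleZ/admissible_tensor.
by move=> w; exact: form_incrementE.
Qed.

Lemma eigen_form psi1 psi2 Psi :
  complex.Re (- lambda * \sum_a pair_form psi1 psi2 a * Psi a) =
  \sum_x \sum_y square_integral beta x y (form_increment psi1 psi2 Psi x y).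
Proof.
have lR := real_linear_Re R.
rewrite -sum_pure -omegaM real_linear_sum //.
under eq_bigr => a _.
  rewrite mulr_sumr real_linear_sum //.
  under eq_bigr do rewrite mulrCA lR.2 mulrC.
  over.
rewrite moment_matrix_sum //; apply: eq_bigr => x _; apply: eq_bigr => y _.
by congr square_integral; apply/funext => w; exact: form_incrementE.
Qed.

(** The rate at which the generator decreases [v]; later [v] is the variance under pi. *)
Definition decay (v : (V -> R) -> R) psi : R :=
  \sum_x \sum_y square_integral beta x y
    (fun w => v psi - v (act (transition x y w) psi)).

(* At a maximiser of the form no increment exceeds its bound by the geometric
   mean, hence by the arithmetic mean, of the two variances. *)
Lemma eigen_bound (v : (V -> R) -> R) psi1 psi2 :
  (forall psi x y, admissible (fun w => v psi - v (act (transition x y w) psi))) ->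
  v psi1 = 1 -> v psi2 = 1 -> 0 < form_norm psi1 psi2 ->
  (forall phi1 phi2, 2 * form_norm phi1 phi2 <=
                     form_norm psi1 psi2 * (v phi1 + v phi2)) ->
  decay v psi1 + decay v psi2 <= 2 * complex.Re lambda.
Proof.
move=> av v1 v2 B0 hB; set B := form_norm psi1 psi2 in B0 hB.
(* The phases of [Psi] make the value of the form exactly [B], a real number, so that the real part
   of the eigenvalue equation reads off Re(lambda). *)
have [Psi Psi1 PsiE] := form_norm_attained psi1 psi2.
have := eigen_form psi1 psi2 Psi; rewrite PsiE -/B mulrC.
rewrite (real_linear_Re R).2 raddfN /= => eqB.
suff : B * - complex.Re lambda <= - (B / 2) * (decay v psi1 + decay v psi2).
  rewrite mulNr mulrN lerN2 -mulrA ler_pM2l // ler_pdivrMl //.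
rewrite eqB /decay -big_split mulr_sumr; apply: ler_sum => x _ /=.
rewrite -big_split mulr_sumr; apply: ler_sum => y _ /=.
rewrite -square_integralD // -square_integralZ //; last exact: admissibleD.
apply: le_square_integral => //; first exact: admissible_form_increment.
  exact/admissibleZ/admissibleD.
move=> w /unit_squareE [w1 w2]; rewrite /form_increment PsiE /= -/B v1 v2.
set K := transition x y w.
have /(form_le_norm (act K psi1) (act K psi2)) : forall a, normc (tensor_act K Psi a) <= 1.
  move=> a; apply: tensor_act_norm => // [x' y'|x'].
    exact: transition_ge0.
  exact: transition_row_sum.
(* Before the jump the form is [B] and both values of [v] are 1; after it the form is at most [B]/2
   times the sum of the new values. *)
by have := hB (act K psi1) (act K psi2); lra.
Qed.

End Form.

(** * Variance and its decay under the generator *)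

Section Variance.
Variables (R : realType) (V : finType) (pi : V -> R).
Hypothesis pi_sum : \sum_x pi x = 1.
Implicit Type psi : V -> R.

Definition l2variance psi : R := \sum_x pi x * (psi x - mean pi psi) ^+ 2.

Lemma l2varianceE psi : l2variance psi = mean pi (fun x => psi x ^+ 2) - mean pi psi ^+ 2.
Proof.
rewrite /l2variance; set m := mean pi psi.
rewrite (eq_bigr (fun x => pi x * psi x ^+ 2 - 2 * m * (pi x * psi x) + m ^+ 2 * pi x)).
  rewrite big_split sumrB -!mulr_sumr pi_sum /= -/(mean pi psi) -/m -/(mean pi _).
  by ring.
by move=> x _; ring.
Qed.

End Variance.

Section VarianceDecay.
Variables (R : realType) (V : finType) (beta : square_measures R V).
Variable pi : V -> R.
Hypothesis hA1 : assumption_A1 beta.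
Hypothesis hpi : rw_invariant beta pi.
Implicit Types (x y : V) (psi g : V -> R) (w : R * R).

Let pi_ge0 x : 0 <= pi x. Proof. by case: hpi. Qed.
Let pi_sum : \sum_x pi x = 1. Proof. by case: hpi. Qed.

Local Notation var := (l2variance pi).

Definition dissipation x y w : R :=
  (pi x * (w.1 * (1 - w.1)) + pi y * (w.2 * (1 - w.2))) +
  (pi x * (1 - w.1) - pi y * (1 - w.2)) ^+ 2.

(** The function [h] is left free to treat the first and second moments together. *)
Lemma mean_act psi (h : R -> R) x y w :
  mean pi (fun z => h (act (transition x y w) psi z)) =
  mean pi (fun z => h (psi z)) +
  (pi x * (h (w.1 * psi x + (1 - w.1) * psi y) - h (psi x)) +
   pi y * (h ((1 - w.2) * psi x + w.2 * psi y) - h (psi y))).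
Proof.
rewrite /mean /act; under eq_bigr do rewrite transition_act.
have [<-{y}|xy] := eqVneq x y.
  have -> : w.1 * psi x + (1 - w.1) * psi x = psi x by ring.
  have -> : (1 - w.2) * psi x + w.2 * psi x = psi x by ring.
  rewrite subrr mulr0 !addr0; apply: eq_bigr => z _.
  by case: eqP => // ->.
have yx : y != x by rewrite eq_sym.
rewrite (bigD1 x) //= [in RHS](bigD1 x) //= (bigD1 y) //= [in RHS](bigD1 y) //=.
rewrite !eqxx (negbTE yx).
rewrite (eq_bigr (fun z => pi z * h (psi z))); first by ring.
by move=> z /andP[/negbTE -> /negbTE ->].
Qed.

(** Averaging two values loses u(1-u) or v(1-v) times their squared difference, which gives the chi
    part; the squared shift of the mean gives the sigma part. The rest is linear in the drift pi_x
    (1-u) - pi_y (1-v), with the increment of psi^2 - 2 mean(psi) psi as coefficient. *)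
Lemma l2variance_act psi x y w :
  var psi - var (act (transition x y w) psi) =
  (psi y - psi x) ^+ 2 * dissipation x y w -
  ((psi y ^+ 2 - 2 * mean pi psi * psi y) -
   (psi x ^+ 2 - 2 * mean pi psi * psi x)) *
  (pi x * (1 - w.1) - pi y * (1 - w.2)).
Proof.
rewrite !(l2varianceE pi_sum) (mean_act psi (fun t => t ^+ 2)).
have -> : mean pi (act (transition x y w) psi) =
  mean pi psi + (pi x * ((w.1 * psi x + (1 - w.1) * psi y) - psi x) +
   pi y * (((1 - w.2) * psi x + w.2 * psi y) - psi y)) by exact: (mean_act psi id).
by rewrite /dissipation; ring.
Qed.

Lemma admissible_drift x y :
  admissible (fun w => pi x * (1 - w.1) - pi y * (1 - w.2)).
Proof.
by apply: admissibleB; apply: admissibleZ; [exact: admissible_fst|exact: admissible_snd].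
Qed.

Lemma admissible_chi x y :
  admissible (fun w => pi x * (w.1 * (1 - w.1)) + pi y * (w.2 * (1 - w.2))).
Proof.
apply: admissibleD; apply/admissibleZ/admissibleM.
- exact: square_bounded_fst.
- exact: admissible_fst.
- exact: square_bounded_snd.
- exact: admissible_snd.
Qed.

Lemma admissible_sigma x y :
  admissible (fun w => (pi x * (1 - w.1) - pi y * (1 - w.2)) ^+ 2).
Proof.
apply: (@admissible_ext R (fun w => (pi x * (1 - w.1) - pi y * (1 - w.2)) *
                              (pi x * (1 - w.1) - pi y * (1 - w.2)))) => //.
apply: admissibleM; last exact: admissible_drift.
apply: square_boundedB; apply: square_boundedM; try exact: square_bounded_cst;
apply: square_boundedB; try exact: square_bounded_cst.
- exact: square_bounded_fst.
- exact: square_bounded_snd.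
Qed.

Lemma admissible_dissipation x y : admissible (dissipation x y).
Proof. by apply: admissibleD; [exact: admissible_chi|exact: admissible_sigma]. Qed.

Lemma admissible_variance_act psi x y :
  admissible (fun w => var psi - var (act (transition x y w) psi)).
Proof.
apply: (@admissible_ext R (fun w => (psi y - psi x) ^+ 2 * dissipation x y w -
  ((psi y ^+ 2 - 2 * mean pi psi * psi y) -
   (psi x ^+ 2 - 2 * mean pi psi * psi x)) *
  (pi x * (1 - w.1) - pi y * (1 - w.2)))) => [|w]; last by rewrite l2variance_act.
apply: admissibleB; apply: admissibleZ; first exact: admissible_dissipation.
exact: admissible_drift.
Qed.

Local Notation I := (square_integral beta).

Lemma chi_sigmaE x y : chi beta pi x y + sigma beta pi x y =
  I x y (dissipation x y) + I y x (dissipation y x).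
Proof.
have split_dissipation u v : I u v (dissipation u v) =
    I u v (fun w => pi u * (w.1 * (1 - w.1)) + pi v * (w.2 * (1 - w.2))) +
    I u v (fun w => (pi u * (1 - w.1) - pi v * (1 - w.2)) ^+ 2).
  rewrite -square_integralD //; first exact: admissible_chi.
  exact: admissible_sigma.
rewrite !split_dissipation /chi /sigma !sym_integralE addrACA.
congr (_ + (_ + _)); apply: eq_square_integral => w _; first by rewrite addrC.
by rewrite -sqrrN opprB.
Qed.

(** This is the stationarity of [pi] tested against [g]: the total is the sum of pi_x r_xy (g(y) -
    g(x)). *)
Lemma invariant_drift g :
  \sum_x \sum_y I x y (fun w => (g y - g x) *
    (pi x * (1 - w.1) - pi y * (1 - w.2))) = 0.
Proof.
pose p x y := I x y (fun w => 1 - w.1); pose q x y := I x y (fun w => 1 - w.2).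
have rE x y : rw_rate beta x y = p x y + q y x by [].
have step x y : I x y (fun w => (g y - g x) * (pi x * (1 - w.1) - pi y * (1 - w.2))) =
    pi x * p x y * (g y - g x) + pi y * q x y * (g x - g y).
  rewrite square_integralZ //; last exact: admissible_drift.
  have -> : (fun w => pi x * (1 - w.1) - pi y * (1 - w.2)) =
            (fun w => pi x * (1 - w.1) + (- pi y) * (1 - w.2)).
    by apply/funext => w; rewrite mulNr.
  rewrite square_integralD //; try exact/admissibleZ/admissible_fst;
    try exact/admissibleZ/admissible_snd.
  rewrite !square_integralZ //; try exact/admissible_fst;
    try exact/admissible_snd.
  by rewrite -/(p x y) -/(q x y); ring.
under eq_bigr do under eq_bigr do rewrite step.
under eq_bigr do rewrite big_split /=.
(* Exchanging x and y in the second half puts the v-integral of beta_yx next to the u-integral of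
   beta_xy, which together form r_xy. *)
rewrite big_split /= [X in _ + X]exchange_big -big_split /=.
have -> : \sum_x (\sum_y pi x * p x y * (g y - g x) +
                  \sum_y pi x * q y x * (g y - g x)) =
          \sum_x \sum_y pi x * rw_rate beta x y * (g y - g x).
  apply: eq_bigr => x _; rewrite -big_split; apply: eq_bigr => y _ /=.
  by rewrite rE; ring.
under eq_bigr do under eq_bigr do rewrite mulrBr.
under eq_bigr do rewrite sumrB.
rewrite sumrB exchange_big -sumrB big1 // => x _; apply/eqP; rewrite subr_eq0; apply/eqP.
rewrite -!mulr_suml; congr (_ * _); rewrite -mulr_sumr.
case: hpi => _ _ /(_ x) inv.
(* The invariance equation omits the diagonal terms, which agree on both sides. *)
by rewrite (bigD1 x) //= inv [in RHS](bigD1 x) //= -mulrDr.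
Qed.

(** The factor 1/2 appears because chi + sigma already collects beta_xy and beta_yx while the sum
    runs over ordered pairs. *)
Lemma decay_variance psi :
  decay beta var psi =
  2^-1 * \sum_x \sum_y (chi beta pi x y + sigma beta pi x y) * (psi y - psi x) ^+ 2.
Proof.
pose g x := psi x ^+ 2 - 2 * mean pi psi * psi x.
have step x y : I x y (fun w => var psi - var (act (transition x y w) psi)) =
    I x y (dissipation x y) * (psi y - psi x) ^+ 2 -
    I x y (fun w => (g y - g x) * (pi x * (1 - w.1) - pi y * (1 - w.2))).
  have -> : (fun w => var psi - var (act (transition x y w) psi)) =
    (fun w => (psi y - psi x) ^+ 2 * dissipation x y w +
       (- (g y - g x)) * (pi x * (1 - w.1) - pi y * (1 - w.2))).
    by apply/funext => w; rewrite l2variance_act mulNr.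
  rewrite square_integralD //; last 2 first.
  - exact/admissibleZ/admissible_dissipation.
  - exact/admissibleZ/admissible_drift.
  rewrite (square_integralZ hA1 _ _ _ (admissible_dissipation x y)).
  by rewrite !(square_integralZ hA1 _ _ _ (admissible_drift x y)); ring.
have -> : decay beta var psi =
    \sum_x \sum_y I x y (dissipation x y) * (psi y - psi x) ^+ 2.
  rewrite -[RHS]subr0 -[X in _ - X](invariant_drift g) -sumrB; apply: eq_bigr => x _.
  by rewrite -sumrB; apply: eq_bigr => y _; exact: step.
have -> : \sum_x \sum_y (chi beta pi x y + sigma beta pi x y) * (psi y - psi x) ^+ 2 =
  \sum_x \sum_y I x y (dissipation x y) * (psi y - psi x) ^+ 2 +
  \sum_x \sum_y I x y (dissipation x y) * (psi y - psi x) ^+ 2.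
  rewrite [X in _ + X]exchange_big -big_split; apply: eq_bigr => x _ /=.
  rewrite -big_split; apply: eq_bigr => y _ /=.
  by rewrite chi_sigmaE; ring.
by rewrite -mulr2n -mulr_natr; field.
Qed.

Lemma sym_integral_ge0 x y (h : R -> R -> R) :
  (forall u v, 0 <= u <= 1 -> 0 <= v <= 1 -> 0 <= h u v) ->
  0 <= sym_integral beta x y h.
Proof.
move=> h0; rewrite sym_integralE; apply: addr_ge0;
by apply: square_integral_ge0 => w /unit_squareE [? ?]; exact: h0.
Qed.

Lemma rw_rate_ge0 x y : 0 <= rw_rate beta x y.
Proof. by apply: sym_integral_ge0 => u v /andP[_ ?] _; rewrite subr_ge0. Qed.

Lemma rw_conductance_ge0 x y : 0 <= rw_conductance beta pi x y.
Proof.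
by rewrite mulr_ge0 ?invr_ge0 ?ler0n // addr_ge0 ?mulr_ge0 ?rw_rate_ge0.
Qed.

Lemma chi_sigma_ge0 x y : 0 <= chi beta pi x y + sigma beta pi x y.
Proof.
apply: addr_ge0; apply: sym_integral_ge0 => u v /andP[? ?] /andP[? ?].
  by rewrite addr_ge0 ?mulr_ge0 ?subr_ge0.
exact: sqr_ge0.
Qed.

Lemma gamma_ge0 : 0 <= gamma beta pi.
Proof.
rewrite /gamma; set A := (X in inf X); have [->|A0] := eqVneq A set0.
  (* The infimum of the empty set is 0 by convention. *)
  by rewrite inf0.
apply: lb_le_inf; first exact/set0P.
by move=> _ [xy _ <-]; rewrite divr_ge0 ?chi_sigma_ge0 ?rw_conductance_ge0.
Qed.

Lemma gamma_conductance x y : x != y ->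
  gamma beta pi * rw_conductance beta pi x y <=
  chi beta pi x y + sigma beta pi x y.
Proof.
(* Pairs of zero conductance are excluded from the infimum, but for them the left side is 0. *)
move=> xy; have := rw_conductance_ge0 x y; rewrite le_eqVlt => /orP[/eqP <-|c0].
  by rewrite mulr0 chi_sigma_ge0.
rewrite -ler_pdivlMr //; apply: ge_inf; last by exists (x, y).
exists 0 => _ [uv _ <-].
by rewrite divr_ge0 ?chi_sigma_ge0 ?rw_conductance_ge0.
Qed.

Lemma rw_dirichlet_ge0 psi : 0 <= rw_dirichlet beta pi psi.
Proof.
rewrite mulr_ge0 ?invr_ge0 ?ler0n //; apply: sumr_ge0 => x _; apply: sumr_ge0 => y _.
by rewrite mulr_ge0 ?rw_conductance_ge0 ?sqr_ge0.
Qed.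

Lemma gamma_dirichlet psi :
  gamma beta pi * rw_dirichlet beta pi psi <= decay beta var psi.
Proof.
rewrite decay_variance /rw_dirichlet mulrCA ler_pM2l ?invr_gt0 ?ltr0n //.
rewrite mulr_sumr; apply: ler_sum => x _; rewrite mulr_sumr big_mkcond /=.
apply: ler_sum => y _; case: ifP => xy.
  by rewrite mulrA ler_wpM2r ?sqr_ge0 ?gamma_conductance.
by rewrite mulr_ge0 ?chi_sigma_ge0 ?sqr_ge0.
Qed.

Lemma gamma_gap_decay psi : var psi = 1 ->
  gamma beta pi * rw_gap beta pi <= decay beta var psi.
Proof.
move=> v1; apply: le_trans (gamma_dirichlet psi).
apply: ler_wpM2l; first exact: gamma_ge0.
apply: ge_inf; first by exists 0 => _ [phi _ <-]; exact: rw_dirichlet_ge0.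
by exists psi => //=; rewrite /l2norm -/(var psi) v1 sqrtr1.
Qed.

End VarianceDecay.

(** * Functions of mean 0 and variance 1 *)

Section Standardisation.
Variables (R : realType) (V : finType) (pi : V -> R).
Hypothesis pi_gt0 : forall x, 0 < pi x.
Hypothesis pi_sum : \sum_x pi x = 1.
Implicit Types (x : V) (psi : V -> R).

Definition standard psi := mean pi psi = 0 /\ mean pi (fun x => psi x ^+ 2) = 1.

Lemma l2variance_ge0 psi : 0 <= l2variance pi psi.
Proof. by apply: sumr_ge0 => x _; rewrite mulr_ge0 ?sqr_ge0 // ltW. Qed.

Lemma l2variance0_cst psi x : l2variance pi psi = 0 -> psi x = mean pi psi.
Proof.
move/eqP; rewrite /l2variance psumr_eq0 => [|y _]; last by rewrite mulr_ge0 ?sqr_ge0 // ltW.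
move=> /allP /(_ x (mem_index_enum x)) /=.
by rewrite mulf_eq0 gt_eqF //= sqrf_eq0 subr_eq0 => /eqP.
Qed.

Lemma standardize_pos psi : 0 < l2variance pi psi -> exists2 phi, standard phi &
  psi = fun x => mean pi psi + Num.sqrt (l2variance pi psi) * phi x.
Proof.
move=> v0; set s := Num.sqrt _; set m := mean pi psi.
have s0 : s != 0 by rewrite gt_eqF // sqrtr_gt0.
exists (fun x => (psi x - m) / s); last by apply/funext => x; field.
split; rewrite /mean.
  under eq_bigr do rewrite mulrA mulrBr.
  by rewrite -mulr_suml sumrB -mulr_suml pi_sum mul1r subrr mul0r.
under eq_bigr do rewrite expr_div_n mulrA.
by rewrite -mulr_suml sqr_sqrtr ?l2variance_ge0 // divff ?gt_eqF.
Qed.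

Hypothesis hV : (2 <= #|V|)%N.

Lemma standard_exists : exists psi, standard psi.
Proof.
have [x [y xy]] : exists x y : V, x != y.
  by move/card_gt1P: hV => [x [y [_ _ xy]]]; exists x, y.
pose psi z : R := (z == x)%:R.
have : 0 < l2variance pi psi.
  rewrite lt_neqAle l2variance_ge0 andbT; apply/eqP => /esym v0.
  have := l2variance0_cst y v0; rewrite -(l2variance0_cst x v0) /psi eqxx eq_sym (negbTE xy).
  by move/eqP; rewrite eq_sym oner_eq0.
by move/standardize_pos => [phi sphi _]; exists phi.
Qed.

(** If the variance is 0 the scale is 0 and any standard [phi] serves; one exists because V has two
    points. *)
Lemma standardize psi : exists2 phi, standard phi &
  psi = fun x => mean pi psi + Num.sqrt (l2variance pi psi) * phi x.
Proof.
have := l2variance_ge0 psi; rewrite le_eqVlt => /orP[/eqP v0|]; last exact: standardize_pos.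
have [phi sphi] := standard_exists; exists phi => //.
by apply/funext => x; rewrite -v0 sqrtr0 mul0r addr0 l2variance0_cst.
Qed.

Lemma l2variance_standard psi : standard psi -> l2variance pi psi = 1.
Proof. by move=> [m0 v1]; rewrite l2varianceE // m0 v1 expr0n subr0. Qed.

(** One term of the second moment gives psi(x)^2 <= 1/pi_x, and 1/pi_x <= (1 + 1/pi_x)^2 spares a
    square root. *)
Lemma standard_bounded psi x : standard psi ->
  - (1 + (pi x)^-1) <= psi x <= 1 + (pi x)^-1.
Proof.
move=> [_ v1]; rewrite -ler_norml.
have p0 : 0 <= (pi x)^-1 by rewrite invr_ge0 ltW.
rewrite -ler_sqr ?nnegrE ?addr_ge0 // real_normK ?num_real //.
have : pi x * psi x ^+ 2 <= 1.
  rewrite -v1 /mean (bigD1 x) //= lerDl sumr_ge0 // => y _.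
  by rewrite mulr_ge0 ?sqr_ge0 // ltW.
rewrite -ler_pdivlMl // mulr1 => /le_trans; apply.
by nra.
Qed.

End Standardisation.

(** * Existence of a maximising pair *)

Section Maximum.
Variables (R : realType) (V : finType) (pi : V -> R).
Hypothesis pi_gt0 : forall x, 0 < pi x.
Hypothesis pi_sum : \sum_x pi x = 1.
Hypothesis hV : (2 <= #|V|)%N.
Variables (k : nat) (omega : tuples V k.+2 -> R[i]).

Lemma continuous_mul (X : topologicalType) (F G : X -> R) :
  continuous F -> continuous G -> continuous (fun f => F f * G f).
Proof. by move=> cF cG f; apply: cvgM; [exact: cF|exact: cG]. Qed.

Lemma continuous_add (X : topologicalType) (F G : X -> R) :
  continuous F -> continuous G -> continuous (fun f => F f + G f).
Proof. by move=> cF cG f; apply: cvgD; [exact: cF|exact: cG]. Qed.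

Lemma continuous_sum (X : topologicalType) (I : Type) (s : seq I)
    (F : I -> X -> R) : (forall i, continuous (F i)) ->
  continuous (fun f => \sum_(i <- s) F i f).
Proof.
move=> cF f; elim: s => [|i s IH].
  by under eq_fun do rewrite big_nil; exact: cst_continuous.
by under eq_fun do rewrite big_cons; apply: cvgD => //; exact: cF.
Qed.

Lemma continuous_sqrt (X : topologicalType) (F : X -> R) :
  continuous F -> continuous (fun f => Num.sqrt (F f)).
Proof. by move=> cF f; apply: continuous_comp; [exact: cF|exact: sqrt_continuous]. Qed.

Lemma normcE (z : R[i]) :
  Normc.normc z = Num.sqrt (complex.Re z * complex.Re z + complex.Im z * complex.Im z).
Proof. by case: z. Qed.

Local Notation X := {ptws (bool * V)%type -> R}.

Let coordinate_continuous (i : bool * V) : continuous (fun f : X => f i).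
Proof. exact: (@proj_continuous _ (fun=> R) i). Qed.

Let form_part_continuous P a : real_linear P ->
  continuous (fun f : X => P (pair_form omega (fun x => f (true, x)) (fun x => f (false, x)) a)).
Proof.
move=> lP.
have -> : (fun f : X => P (pair_form omega (fun x => f (true, x)) (fun x => f (false, x)) a)) =
  (fun f : X => \sum_x \sum_y (f (true, x) * f (false, y)) * P (omega (x, (y, a)))).
  apply/funext => f; rewrite /pair_form real_linear_sum //; apply: eq_bigr => x _.
  by rewrite real_linear_sum //; apply: eq_bigr => y _; rewrite lP.2.
apply: continuous_sum => x; apply: continuous_sum => y.
apply: continuous_mul; last by move=> f; exact: cst_continuous.
by apply: continuous_mul; exact: coordinate_continuous.
Qed.

Let form_norm_continuous : continuous (fun f : X =>
  form_norm omega (fun x => f (true, x)) (fun x => f (false, x))).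
Proof.
apply: continuous_sum => a.
rewrite (funext (fun f : X => normcE (pair_form omega _ _ a))).
apply: continuous_sqrt.
have cRe := form_part_continuous (a := a) (real_linear_Re R).
have cIm := form_part_continuous (a := a) (real_linear_Im R).
by apply: continuous_add; apply: continuous_mul.
Qed.

Let mean_continuous b (h : R -> R) : continuous h ->
  continuous (fun f : X => mean pi (fun x => h (f (b, x)))).
Proof.
move=> ch; apply: continuous_sum => x.
apply: continuous_mul => f; first exact: cst_continuous.
apply: (@continuous_comp _ _ _ (fun f : X => f (b, x)) h); last exact: ch.
exact: coordinate_continuous.
Qed.

(** The pair is coded as one point of a product of lines indexed by [bool * V]. Standard pairs form
    a closed subset of a box, which is compact by Tychonoff, and the norm of the form is
    continuous. *)
Lemma form_norm_max : exists psi1 psi2, [/\ standard pi psi1, standard pi psi2 &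
  forall phi1 phi2, standard pi phi1 -> standard pi phi2 ->
    form_norm omega phi1 phi2 <= form_norm omega psi1 psi2].
Proof.
pose box := [set f : X | forall i, `[- (1 + (pi i.2)^-1), 1 + (pi i.2)^-1]%classic (f i)].
pose S := box `&` [set f : X | standard pi (fun x => f (true, x))]
              `&` [set f : X | standard pi (fun x => f (false, x))].
have closed_standard b : closed [set f : X | standard pi (fun x => f (b, x))].
  have closed_fiber (h : R -> R) c : continuous h ->
      closed [set f : X | mean pi (fun x => h (f (b, x))) = c].
    move=> ch; apply: (@preimage_closed X R _ [set c]); last exact: closed_eq.
    by move=> f _; exact: mean_continuous.
  apply: closedI; first by apply: (closed_fiber id) => z; exact: cvg_id.
  by apply: (closed_fiber (fun t => t ^+ 2)); exact: exprn_continuous.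
have cS : compact S.
  apply: compact_closedI; last exact: closed_standard.
  apply: compact_closedI; last exact: closed_standard.
  apply: (@tychonoff (bool * V)%type (fun=> R)
    (fun i => `[- (1 + (pi i.2)^-1), 1 + (pi i.2)^-1]%classic)) => i.
  exact: segment_compact.
have inS phi1 phi2 : standard pi phi1 -> standard pi phi2 ->
    S (fun i : bool * V => if i.1 then phi1 i.2 else phi2 i.2).
  move=> s1 s2; split=> //; split=> // -[b x] /=; rewrite in_itv /=.
  by case: b; exact: standard_bounded.
have [psi spsi] := standard_exists pi_gt0 pi_sum hV.
have [|f fS fmax] := compact_EVT_max _ cS (continuous_subspaceT form_norm_continuous).
  by exists (fun i : bool * V => if i.1 then psi i.2 else psi i.2); exact: inS.
exists (fun x => f (true, x)), (fun x => f (false, x)).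
move: fS; rewrite inE => -[[_ s1] s2]; split=> // phi1 phi2 t1 t2.
by have := fmax _ (mem_set (inS _ _ t1 t2)).
Qed.

End Maximum.

(** * Positivity of the invariant probability *)

Section Positivity.
Variables (R : realType) (V : finType) (beta : square_measures R V).
Variable pi : V -> R.
Hypotheses (hA1 : assumption_A1 beta) (hA2 : assumption_A2 beta).
Hypothesis hpi : rw_invariant beta pi.
Implicit Types x y : V.

Lemma swap_rate_ge0 x y : 0 <= swap_rate beta x y.
Proof.
apply: sym_integral_ge0 => u v /andP[? ?] _.
by rewrite mulr_ge0 ?subr_ge0.
Qed.

Lemma swap_le_rw_rate x y : swap_rate beta x y <= rw_rate beta x y.
Proof.
rewrite /swap_rate /rw_rate !sym_integralE; apply: lerD.
  apply: le_square_integral => //; last 2 first.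
  - exact: admissible_fst.
  - move=> w /unit_squareE [/andP[? ?] _].
    by rewrite ler_piMl ?subr_ge0.
  exact: admissibleM (square_bounded_fst R) (admissible_fst R).
apply: le_square_integral => //; last 2 first.
- exact: admissible_snd.
- move=> w /unit_squareE [_ /andP[? ?]].
  by rewrite ler_piMl ?subr_ge0.
exact: admissibleM (square_bounded_snd R) (admissible_snd R).
Qed.

(** If pi_y = 0, invariance at y says that the inflow into y is 0, hence so is each term pi_x r_xy,
    while r_xy >= s_xy > 0. *)
Lemma pi_eq0_step x y : 0 < swap_rate beta x y -> pi y = 0 -> pi x = 0.
Proof.
move=> /lt_le_trans /(_ (swap_le_rw_rate x y)) rxy py.
have [->//|xy] := eqVneq x y.
case: hpi => pi0 _ /(_ y) /eqP.
rewrite py mul0r psumr_eq0 => [|z _]; last by rewrite mulr_ge0 ?rw_rate_ge0.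
move=> /allP /(_ x (mem_index_enum x)) /implyP /(_ xy).
by rewrite mulf_eq0 (gt_eqF rxy) orbF => /eqP.
Qed.

Lemma pi_eq0_path s x y :
  0 < \prod_(t <- pairmap (swap_rate beta) x (rcons s y)) t -> pi y = 0 -> pi x = 0.
Proof.
elim: s x => [|z s IH] x /=.
  by rewrite big_seq1; exact: pi_eq0_step.
rewrite big_cons => prod0 py.
have : 0 < swap_rate beta x z.
  rewrite lt_neqAle swap_rate_ge0 andbT eq_sym.
  by apply: contraTneq prod0 => ->; rewrite mul0r ltxx.
move=> sxz; apply: (pi_eq0_step sxz); apply: IH py.
by rewrite pmulr_rgt0 in prod0.
Qed.

(** A zero at one point would spread along the paths of (A2) to all of V, against total mass 1. *)
Lemma pi_gt0 x : 0 < pi x.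
Proof.
have [pi0 pi1 _] := hpi; rewrite lt_neqAle pi0 andbT eq_sym; apply/eqP => px.
have : \sum_y pi y = 0.
  apply: big1 => y _; have [s] := hA2 y x; move/pi_eq0_path; exact.
by rewrite pi1 => /eqP; rewrite oner_eq0.
Qed.

End Positivity.

(** * From the maximum to the spectral bound *)

Theorem theorem2p8 (R : realType) (V : finType) (hV : (2 <= #|V|)%N)
  (beta : square_measures R V)
  (beta_diag : forall x : V, beta x x (unit_square R) = 0%E)
  (hA1 : assumption_A1 beta) (hA2 : assumption_A2 beta)
  (pi : V -> R) (hpi : rw_invariant beta pi)
  (k : nat) (hk : (2 <= k)%N) (lambda : R[i])
  (hlambda : eigenvalue_on (fun f eta => - generator beta f eta)
               (@poly_functions R V k) lambda)
  (hlambda' : ~ eigenvalue_on (fun f eta => - generator beta f eta)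
                  (@poly_functions R V k.-1) lambda) :
  gamma beta pi * rw_gap beta pi <= complex.Re lambda.
Proof.
have pi1 : \sum_x pi x = 1 by case: hpi.
have pi0 := pi_gt0 hA1 hA2 hpi.
case: k hk hlambda hlambda' => [//|[//|k']] _ eigen noteigen.
have [omega [[[x [y a]] omega0] omegaU omegaM]] :=
  eigen_functional hA1 beta_diag eigen noteigen.
have [psi1 [psi2 [s1 s2 psimax]]] := form_norm_max pi0 pi1 hV omega.
set B := form_norm omega psi1 psi2 in psimax.
(* Constants drop out of the form, so standardising leaves the factor [r * t] of the two standard
   deviations, and 2rt <= r^2 + t^2. *)
have bound phi1 phi2 : 2 * form_norm omega phi1 phi2 <=
    B * (l2variance pi phi1 + l2variance pi phi2).
  have B0 : 0 <= B by apply: sumr_ge0 => b _; exact: normc_ge0.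
  have v1 := l2variance_ge0 pi0 phi1; have v2 := l2variance_ge0 pi0 phi2.
  have [chi1 c1 e1] := standardize pi0 pi1 hV phi1.
  have [chi2 c2 e2] := standardize pi0 pi1 hV phi2.
  have -> : form_norm omega phi1 phi2 = Num.sqrt (l2variance pi phi1) *
      Num.sqrt (l2variance pi phi2) * form_norm omega chi1 chi2.
    by rewrite [in LHS]e1 [in LHS]e2 (form_norm_affine omegaU) ?sqrtr_ge0.
  have := psimax _ _ c1 c2; set F := form_norm _ _ _ => FB.
  rewrite -{2}(sqr_sqrtr v1) -{2}(sqr_sqrtr v2).
  have := sqrtr_ge0 (l2variance pi phi1); have := sqrtr_ge0 (l2variance pi phi2).
  set t := Num.sqrt _; set r := Num.sqrt _ => t0 r0.
  have rtFB : r * t * F <= r * t * B by rewrite ler_wpM2l ?mulr_ge0.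
  have : 0 <= B * (r - t) ^+ 2 by rewrite mulr_ge0 ?sqr_ge0.
  by nra.
(* A nonzero entry of [omega] is a value of the form at two indicators; [bound] at this pair
   excludes [B <= 0]. *)
have B0 : 0 < B.
  have : 0 < form_norm omega (fun z => (z == x)%:R) (fun z => (z == y)%:R).
    rewrite /form_norm (bigD1 a) //= form_delta ltr_pwDl //; last first.
      by apply: sumr_ge0 => b _; exact: normc_ge0.
    rewrite lt_neqAle normc_ge0 andbT eq_sym.
    by apply: contra omega0 => /eqP /Normc.eq0_normc ->.
  move=> F0; have := bound (fun z => (z == x)%:R) (fun z => (z == y)%:R).
  move/(lt_le_trans (mulr_gt0 (ltr0n R 2) F0)).
  apply: contraTT; rewrite -!leNgt => /mulr_le0_ge0; apply.
  by apply: addr_ge0; exact: l2variance_ge0.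
have := eigen_bound hA1 omegaM (admissible_variance_act hpi)
  (l2variance_standard pi1 s1) (l2variance_standard pi1 s2) B0 bound.
have := gamma_gap_decay hA1 hpi (l2variance_standard pi1 s1).
have := gamma_gap_decay hA1 hpi (l2variance_standard pi1 s2).
by lra.
Qed.
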